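(* Let $\Delta$ be a pure simplicial complex on $[n]$ which has rigid depth over a field of characteristic $0$. Then $\Delta$ has rigid depth over any field.
   Context: For a field $K$ let $S=K[x_1,\ldots,x_n]$. For a simplicial complex $\Delta$ on $[n]=\{1,\ldots,n\}$ with facet set $\mathcal{F}(\Delta)$, the Stanley-Reisner ideal is $I_\Delta=\bigcap_{F\in\mathcal{F}(\Delta)}(x_i\mid i\notin F)\subset S$; $\Delta$ is pure if all its facets have the same cardinality. Simplicial complexes are nonempty. An ideal $I\subset S$ is unmixed if the associated primes of $S/I$ are exactly the minimal primes of $I$. A pure simplicial complex $\Delta$ has rigid depth over $K$ if for every unmixed monomial ideal $I\subset S$ with $\sqrt{I}=I_\Delta$ one has $\operatorname{depth}(S/I)=\operatorname{depth}(S/I_\Delta)$, depth being with respect to $(x_1,\ldots,x_n)$. *)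

(* Defs.v *)
From mathcomp Require Import all_boot all_order all_algebra.
From mathcomp Require Import mpoly.

Set Implicit Arguments.
Unset Strict Implicit.
Unset Printing Implicit Defensive.

Import GRing.Theory.
Local Open Scope ring_scope.

Section Complexes.
Variable n : nat.
Implicit Type D : {set {set 'I_n}}.

(* The empty set is a face of every complex; a vertex i need not be a face. *)
Definition simplicial_complex D : Prop :=
  D != set0 /\ (forall F G : {set 'I_n}, F \in D -> G \subset F -> G \in D).

Definition facets D : {set {set 'I_n}} :=
  [set F | maxset (fun A : {set 'I_n} => A \in D) F].

Definition pure D : Prop :=
  forall F G : {set 'I_n}, F \in facets D -> G \in facets D -> #|F| = #|G|.

End Complexes.

(* Ideals are Prop-valued predicates, compared extensionally. *)
Section Ideals.
Variable R : comNzRingType.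
Implicit Types I P : R -> Prop.

Definition ideal I : Prop :=
  [/\ I 0, forall f g, I f -> I g -> I (f + g) & forall f g, I g -> I (f * g)].

Definition gen_ideal (A : R -> Prop) (f : R) : Prop :=
  forall J : R -> Prop, ideal J -> (forall a, A a -> J a) -> J f.

Definition radical I (f : R) : Prop := exists k : nat, I (f ^+ k).

Definition prime_ideal P : Prop :=
  [/\ ideal P, ~ P 1 & forall f g, P (f * g) -> P f \/ P g].

Definition minimal_prime I P : Prop :=
  [/\ prime_ideal P, forall f, I f -> P f &
      forall Q : R -> Prop, prime_ideal Q -> (forall f, I f -> Q f) ->
        (forall f, Q f -> P f) -> forall f, P f -> Q f].

(* P is an associated prime of the module R/I: P is the annihilator of the
   class of some g. *)
Definition associated_prime I P : Prop :=
  prime_ideal P /\ exists g : R, forall f, P f <-> I (f * g).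

Definition unmixed I : Prop :=
  forall P : R -> Prop, associated_prime I P <-> minimal_prime I P.

Definition ideal_plus I (s : seq R) : R -> Prop :=
  gen_ideal (fun g => I g \/ g \in s).

(* s is a regular sequence on R/I: each s_i is a non-zero-divisor on
   R/(I + (s_0, ..., s_(i-1))), and R/(I + (s)) is nonzero. *)
Definition regular_seq I (s : seq R) : Prop :=
  (forall i : nat, (i < size s)%N -> forall g : R,
     ideal_plus I (take i s) (s`_i * g) -> ideal_plus I (take i s) g)
  /\ ~ ideal_plus I s 1.

(* depth of the module R/I with respect to m, as the maximal length of an
   R/I-regular sequence in m. *)
Definition is_depth (m I : R -> Prop) (d : nat) : Prop :=
  (exists s : seq R,
     [/\ size s = d, forall f, f \in s -> m f & regular_seq I s])
  /\ (forall s : seq R,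
        (forall f, f \in s -> m f) -> regular_seq I s -> (size s <= d)%N).

End Ideals.

Section StanleyReisner.
Variables (n : nat) (K : fieldType).
Implicit Types (I : {mpoly K[n]} -> Prop) (D : {set {set 'I_n}}).

Definition var_ideal (A : {set 'I_n}) : {mpoly K[n]} -> Prop :=
  gen_ideal (fun g => exists2 i, i \in A & g = 'X_i).

Definition stanley_reisner D (f : {mpoly K[n]}) : Prop :=
  forall F : {set 'I_n}, F \in facets D -> var_ideal (~: F) f.

Definition monomial_ideal I : Prop :=
  exists M : 'X_{1..n} -> Prop,
    forall f, I f <-> gen_ideal (fun g => exists2 u, M u & g = 'X_[u]) f.

End StanleyReisner.

(* Equality of depths is stated as: the same d is the depth of both quotients,
   i.e. equality of the suprema of the lengths of regular sequences. *)
Definition rigid_depth (n : nat) (K : fieldType) (D : {set {set 'I_n}}) : Prop :=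
  forall I : {mpoly K[n]} -> Prop,
    monomial_ideal I -> unmixed I ->
    (forall f, radical I f <-> stanley_reisner D f) ->
    forall d : nat, is_depth (var_ideal [set: 'I_n]) I d <->
                    is_depth (var_ideal [set: 'I_n]) (stanley_reisner (K := K) D) d.

Arguments rigid_depth {n} K D.

(* Main.v *)
Require Import Defs.
From Stdlib Require Import Classical ClassicalEpsilon.
From Stdlib Require Import FunctionalExtensionality PropExtensionality.
From HB Require Import structures.
From mathcomp Require Import all_boot all_order all_algebra.
From mathcomp Require Import ring zify.
From mathcomp Require Import mpoly.

(* Over any field F, depth S/I >= d iff the Koszul cohomology H^i(x; S/I)
   vanishes for i < d, and the powers x_j^k may replace the x_j. Let t be the
   minimum of |F_1 n ... n F_r| + r - 1 over the nonempty sets of facets.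
   - An unmixed I with radical I_Delta is the intersection of its localizations
     Q_F = (I : x_F^oo), and x_j (j in F_1 n ... n F_r) is regular modulo
     Q_{F_1} + ... + Q_{F_r}; Mayer-Vietoris gives depth S/I >= t over any field.
   - If F_1, ..., F_r attain t, take I with Q_F = (x_j^2 : j not in F) for F among
     the F_i, and Q_F = (x_j : j not in F) otherwise. Extracting from S/I the
     monomials with all exponents odd exhibits S/(P_{F_1} n ... n P_{F_r}) as a
     direct summand, and Mayer-Vietoris again gives depth S/I = t. Hence rigidity
     over K means depth S/I_Delta = t over K.
   - Graded pieces of the Koszul complex of S/I_Delta are defined by integer
     matrices, whose ranks over K of characteristic 0 are maximal; so
     depth S/I_Delta over L is at most t.
   - Extracting k-th powers for large k makes S/I_Delta a summand of S/I, whence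
     depth S/I <= depth S/I_Delta <= t over L. *)

Set Implicit Arguments.
Unset Strict Implicit.
Unset Printing Implicit Defensive.

Import GRing.Theory Order.TTheory.
Local Open Scope ring_scope.

(** * Koszul cohomology *)

Lemma exists_choice (A B : Type) (R : A -> B -> Prop) :
  (forall x, exists y, R x y) -> exists f, forall x, R x (f x).
Proof.
move=> h; exists (fun x => proj1_sig (constructive_indefinite_description _ (h x))).
by move=> x; case: constructive_indefinite_description.
Qed.

Lemma pred_ext (A : Type) (P Q : A -> Prop) : (forall x, P x <-> Q x) -> P = Q.
Proof.
by move=> h; apply: functional_extensionality => x; apply: propositional_extensionality.
Qed.

(** * Arithmetic of ideals given as predicates *)

Section IdealClosure.
Variable R : comNzRingType.
Implicit Types I J : R -> Prop.

Lemma ideal_zero I : ideal I -> I 0. Proof. by case. Qed.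

Lemma ideal_addr I f g : ideal I -> I f -> I g -> I (f + g).
Proof. by case=> _ h _; apply: h. Qed.

Lemma ideal_mull I f g : ideal I -> I g -> I (f * g).
Proof. by case=> _ _ h; apply: h. Qed.

Lemma ideal_mulr I f g : ideal I -> I f -> I (f * g).
Proof. by rewrite mulrC; apply: ideal_mull. Qed.

Lemma ideal_opp I f : ideal I -> I f -> I (- f).
Proof. by rewrite -mulN1r; apply: ideal_mull. Qed.

Lemma ideal_sub I f g : ideal I -> I f -> I g -> I (f - g).
Proof. by move=> hI If Ig; apply: ideal_addr => //; apply: ideal_opp. Qed.

Lemma ideal_subl I f g : ideal I -> I g -> I (f - g) -> I f.
Proof. by move=> hI Ig /(ideal_addr hI Ig); rewrite addrC subrK. Qed.

Lemma ideal_sum I (T : Type) (r : seq T) (P : pred T) (F : T -> R) :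
  ideal I -> (forall i, P i -> I (F i)) -> I (\sum_(i <- r | P i) F i).
Proof.
by move=> hI hF; apply: big_ind => //; [apply: ideal_zero|move=> ? ?; apply: ideal_addr].
Qed.

Definition ideal_add I J (f : R) : Prop := exists2 a, I a & J (f - a).

Definition ideal_adjoin I s (f : R) : Prop := exists r, I (f - r * s).

Lemma ideal_adjoinP I s : ideal I -> ideal (ideal_adjoin I s).
Proof.
move=> hI; split.
- by exists 0; rewrite mul0r subr0; apply: ideal_zero.
- move=> f g [r1 h1] [r2 h2]; exists (r1 + r2).
  by rewrite mulrDl opprD addrACA; apply: ideal_addr.
- move=> f g [r h]; exists (f * r).
  by rewrite -mulrA -mulrBr; apply: ideal_mull.
Qed.

Lemma ideal_adjoin_sub I s f : I f -> ideal_adjoin I s f.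
Proof. by move=> If; exists 0; rewrite mul0r subr0. Qed.

Lemma ideal_adjoin_gen I s : ideal I -> ideal_adjoin I s s.
Proof. by move=> hI; exists 1; rewrite mul1r subrr; apply: ideal_zero. Qed.

Definition regular_mod I s : Prop := forall g, I (s * g) -> I g.

End IdealClosure.

(** * The Koszul cochain complex and its long exact sequences *)

Section Koszul.
Variables (n : nat) (R : comNzRingType) (y : 'I_n -> R).
Implicit Types (A B : {set 'I_n}) (c e : {set 'I_n} -> R) (I J : R -> Prop).

Definition ksgn (i : 'I_n) B : R := (-1) ^+ #|[set j in B | (j < i)%N]|.

(* A Koszul cochain of degree i with values in R/J is a function on sets of
   indices, only its values on i-element sets, modulo J, being relevant. *)
Definition kdiff c B : R := \sum_(i in B) ksgn i B * (y i * c (B :\ i)).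

Lemma ksgnK i B : ksgn i B * ksgn i B = 1.
Proof. by rewrite -expr2 sqrr_sign. Qed.

Lemma ksgnD1 i j B : j \in B -> ksgn i B = (-1) ^+ (j < i)%N * ksgn i (B :\ j).
Proof.
move=> jB; rewrite /ksgn -exprD; congr (_ ^+ _).
rewrite (cardsD1 j) inE jB /=; congr (_ + _)%N.
by apply: eq_card => k; rewrite !inE; case: (k == j); rewrite ?andbF.
Qed.

Lemma ksgn_swap i j B : i \in B -> j \in B -> i != j ->
  ksgn i B * ksgn j (B :\ i) = - (ksgn j B * ksgn i (B :\ j)).
Proof.
move=> iB jB ij; rewrite (ksgnD1 i jB) (ksgnD1 j iB).
have : val i != val j by [].
case: ltngtP => //= h _; rewrite ?expr0 ?expr1; ring.
Qed.

Lemma kdiffB c e B : kdiff (fun A => c A - e A) B = kdiff c B - kdiff e B.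
Proof. by rewrite /kdiff -sumrB; apply: eq_bigr => i _; ring. Qed.

Lemma kdiffD c e B : kdiff (fun A => c A + e A) B = kdiff c B + kdiff e B.
Proof. by rewrite /kdiff -big_split; apply: eq_bigr => i _ /=; ring. Qed.

Lemma kdiffZ s c B : kdiff (fun A => s * c A) B = s * kdiff c B.
Proof. by rewrite /kdiff mulr_sumr; apply: eq_bigr => i _; ring. Qed.

Lemma kdiff0 c : kdiff c set0 = 0.
Proof. by rewrite /kdiff big_set0. Qed.

Lemma kdiff_ideal J c B : ideal J -> (forall i, i \in B -> J (c (B :\ i))) ->
  J (kdiff c B).
Proof.
by move=> hJ h; apply: ideal_sum => // i iB; do 2!apply: ideal_mull => //; apply: h.
Qed.

(** The terms indexed by [(i, j)] and [(j, i)] cancel by [ksgn_swap]; cutting the double sum along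
    [j < i] and [i < j] pairs them. *)
Lemma kdiff_kdiff c B : kdiff (kdiff c) B = 0.
Proof.
rewrite /kdiff.
pose T i j := ksgn i B * (y i * (ksgn j (B :\ i) * (y j * c (B :\ i :\ j)))).
transitivity (\sum_(i in B) \sum_(j in B | j != i) T i j).
  apply: eq_bigr => i iB; rewrite !mulr_sumr; apply: eq_big => j.
    by rewrite !inE andbC.
  by rewrite /T.
rewrite (eq_bigr (fun i : 'I_n => \sum_(j in B | (j < i)%N) T i j
                         + \sum_(j in B | (i < j)%N) T i j)); last first.
  move=> i iB; rewrite (bigID (fun j : 'I_n => (j < i)%N)) /=; congr (_ + _).
    apply: eq_bigl => j; rewrite -andbA; congr (_ && _).
    by rewrite -val_eqE /=; case: ltngtP.
  apply: eq_bigl => j; rewrite -andbA; congr (_ && _).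
  by rewrite -val_eqE /=; case: ltngtP.
rewrite big_split /=.
rewrite [X in _ + X](exchange_big_dep (mem B)) //=; last by move=> i j _ /andP[].
rewrite -big_split /= big1 // => i iB.
rewrite (eq_bigl (fun j => (j \in B) && (j < i)%N)) //.
rewrite [X in _ + X](eq_bigl (fun j => (j \in B) && (j < i)%N)); last first.
  by move=> j; rewrite iB.
rewrite -big_split /= big1 // => j /andP[jB ji].
have ij : i != j by rewrite -val_eqE /= gtn_eqF.
rewrite /T setDDl setUC -setDDl.
set X := c _.
transitivity ((ksgn i B * ksgn j (B :\ i) + ksgn j B * ksgn i (B :\ j)) * (y i * (y j * X))); first by ring.
by rewrite ksgn_swap // addNr mul0r.
Qed.

Definition khom j c A : R := if j \in A then 0 else ksgn j (j |: A) * c (j |: A).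

(* [khom j] is a chain homotopy, whence [y j] kills Koszul cohomology. *)
Lemma khomP j c A : kdiff (khom j c) A + khom j (kdiff c) A = y j * c A.
Proof.
case: (boolP (j \in A)) => jA.
  rewrite {2}/khom jA addr0 /kdiff (bigD1 j) //= big1 ?addr0; last first.
    by move=> i /andP[iA ij]; rewrite /khom !inE eq_sym ij jA !mulr0.
  rewrite /khom !inE eqxx /= setD1K // -[RHS]mul1r -(ksgnK j A); ring.
rewrite /khom (negbTE jA) {2}/kdiff (bigD1 j) ?setU11 //= setU1K // mulrDr.
have -> : ksgn j (j |: A) * (ksgn j (j |: A) * (y j * c A)) = y j * c A.
  by rewrite mulrA ksgnK mul1r.
rewrite addrCA -[RHS]addr0; congr (_ + _).
rewrite (eq_bigl (mem A)); last first.
  by move=> i; rewrite !inE; case: eqP => [->|] /=; rewrite ?andbF ?(negbTE jA) ?andbT.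
rewrite mulr_sumr /kdiff -big_split /= big1 // => i iA.
have ij : i != j by apply: contraNneq jA => <-.
rewrite !inE (negbTE jA) andbF.
have E : j |: A :\ i = (j |: A) :\ i.
  apply/setP => k; rewrite !inE; case: (k =P j) => [->|] //=.
  by rewrite eq_sym ij.
rewrite E.
have := @ksgn_swap i j (j |: A); rewrite !inE iA eqxx orbT ij => /(_ isT isT isT).
rewrite setU1K // => S.
set X := c _.
transitivity ((ksgn i A * ksgn j ((j |: A) :\ i) + ksgn j (j |: A) * ksgn i (j |: A)) * (y i * X)); first by ring.
have -> : ksgn i A = ksgn j (j |: A) * (ksgn j (j |: A) * ksgn i A).
  by rewrite mulrA ksgnK mul1r.
have -> : ksgn j (j |: A) * ksgn i A = - (ksgn i (j |: A) * ksgn j ((j |: A) :\ i)).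
  by rewrite S opprK.
rewrite (_ : _ + _ = ksgn j (j |: A) * ksgn i (j |: A) * (1 - ksgn j ((j |: A) :\ i) * ksgn j ((j |: A) :\ i))); last by ring.
by rewrite ksgnK subrr mulr0 mul0r.
Qed.

Definition kcocycle J i c : Prop := forall B, #|B| = i.+1 -> J (kdiff c B).

(** In degree 0 the differential [kdiff e set0] is zero, so the condition just says that [c set0]
    lies in [J]. *)
Definition kcobound J i c : Prop :=
  exists e, forall A, #|A| = i -> J (c A - kdiff e A).

Definition koszul_vanish J d : Prop :=
  forall i c, (i < d)%N -> kcocycle J i c -> kcobound J i c.

Lemma koszul_vanish_le J d d' : (d' <= d)%N -> koszul_vanish J d -> koszul_vanish J d'.
Proof. by move=> le h i c /leq_trans/(_ le); apply: h. Qed.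

Lemma card_setD1 A i k : #|A| = k.+1 -> i \in A -> #|A :\ i| = k.
Proof. by move=> hA iA; move: hA; rewrite (cardsD1 i) iA; case. Qed.

(** Long exact sequence of 0 -> R/J -s-> R/J -> R/(J,s) -> 0: H^i(R/(J,s)) lies between H^i(R/J) and
    H^(i+1)(R/J). *)
Lemma koszul_vanish_adjoin J s d : ideal J -> regular_mod J s ->
  koszul_vanish J d.+1 -> koszul_vanish (ideal_adjoin J s) d.
Proof.
move=> hJ sreg h i c id hc.
(* [b] represents the image under the connecting map: [kdiff c] is [s * b] modulo [J]. *)
have [b hb] : exists b, forall B, #|B| = i.+1 -> J (kdiff c B - b B * s).
  apply: (@exists_choice _ _ (fun B r => #|B| = i.+1 -> J (kdiff c B - r * s))) => B.
  case: (eqVneq #|B| i.+1) => [/hc [r hr]|/eqP neq]; first by exists r.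
  by exists 0.
have /h : (i.+1 < d.+1)%N by [].
case/(_ b).
  move=> B hB; apply: sreg; rewrite -kdiffZ.
  have : J (kdiff (fun A => kdiff c A - b A * s) B).
    by apply: kdiff_ideal => // k kB; apply: hb; apply: card_setD1 kB.
  rewrite kdiffB kdiff_kdiff sub0r => /(ideal_opp hJ); rewrite opprK.
  by congr J; apply: eq_bigr => k _; congr (_ * (_ * _)); rewrite mulrC.
move=> e he.
have /h : (i < d.+1)%N by rewrite ltnW.
case/(_ (fun A => c A - s * e A)).
  move=> B hB; rewrite kdiffB kdiffZ.
  rewrite (_ : _ - _ = (kdiff c B - b B * s) + s * (b B - kdiff e B)); last by ring.
  by apply: ideal_addr => //; [apply: hb|apply: ideal_mull => //; apply: he].
move=> e' he'; exists e' => A hA; exists (e A).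
by rewrite (_ : _ - _ = c A - s * e A - kdiff e' A); [apply: he'|ring].
Qed.

(** The annihilator of the Koszul cohomology of R/J, in all degrees at once. *)
Definition knull J s : Prop :=
  forall i c, kcocycle J i c -> kcobound J i (fun A => s * c A).

Lemma knull_ideal J : ideal J -> ideal (knull J).
Proof.
move=> hJ; split.
- move=> i c _; exists (fun=> 0) => A _.
  rewrite mul0r sub0r; apply: ideal_opp => //.
  by apply: kdiff_ideal => // *; apply: ideal_zero.
- move=> f g hf hg i c hc; have [e he] := hf _ _ hc; have [e' he'] := hg _ _ hc.
  exists (fun A => e A + e' A) => A hA; rewrite kdiffD mulrDl opprD addrACA.
  by apply: ideal_addr => //; [apply: he|apply: he'].
- move=> f g hg i c hc; have [e he] := hg _ _ hc.
  exists (fun A => f * e A) => A hA; rewrite kdiffZ -mulrA -mulrBr.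
  by apply: ideal_mull => //; apply: he.
Qed.

Lemma knull_gen J j : ideal J -> knull J (y j).
Proof.
move=> hJ i c hc; exists (khom j c) => A hA.
rewrite -khomP addrAC subrr add0r /khom; case: ifP => [_|jA]; first exact: ideal_zero.
by apply: ideal_mull => //; apply: hc; rewrite cardsU1 jA hA.
Qed.

(** Vanishing of H^(i-1)(R/(J,s)) makes [s] injective on H^i(R/J); a power of [s] kills this module,
    which is therefore zero. *)
Lemma koszul_vanish_of_adjoin J s N d : ideal J -> regular_mod J s -> knull J (s ^+ N) ->
  koszul_vanish (ideal_adjoin J s) d -> koszul_vanish J d.+1.
Proof.
move=> hJ sreg snull h i c; rewrite ltnS => id hc.
(* [s] acts injectively on the cohomology in degree i *)
have inj : forall c', kcobound J i (fun A => s * c' A) -> kcobound J i c'.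
  move=> c' [e he]; case: i id {hc c} he => [|i] id he.
    (* Degree 0: coboundaries are zero, and injectivity is the regularity of [s]. *)
    exists (fun=> 0) => A hA; move/cards0_eq: (hA) => eA; move: (he _ hA).
    by rewrite eA !kdiff0 !subr0 => /sreg.
  have [] := h i e id.
    move=> B hB; exists (c' B); have := he _ hB => /(ideal_opp hJ).
    by congr J; ring.
  move=> e' he'.
  have [r hr] : exists r, forall A, #|A| = i -> J (e A - kdiff e' A - r A * s).
    apply: (@exists_choice _ _ (fun A r => #|A| = i -> J (e A - kdiff e' A - r * s))) => A.
    case: (eqVneq #|A| i) => [/he' [r hr]|/eqP neq]; first by exists r.
    by exists 0.
  exists r => A hA; apply: sreg.
  have : J (kdiff (fun B => e B - kdiff e' B - r B * s) A).
    by apply: kdiff_ideal => // k kA; apply: hr; apply: card_setD1 kA.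
  rewrite !kdiffB kdiff_kdiff subr0 => /(ideal_addr hJ (he _ hA)); congr J.
  have -> : kdiff (fun B => r B * s) A = s * kdiff r A.
    by rewrite -kdiffZ; apply: eq_bigr => k _; congr (_ * (_ * _)); rewrite mulrC.
  by ring.
have {snull}: kcobound J i (fun A => s ^+ N * c A) by apply: snull.
elim: N => [|N IH].
  by case=> e he; exists e => A hA; have := he _ hA; rewrite expr0 mul1r.
move=> [e he]; apply: IH; apply: inj; exists e => A hA.
by rewrite mulrA -exprS; apply: he.
Qed.

(** Mayer-Vietoris for 0 -> R/(I n J) -> R/I + R/J -> R/(I + J) -> 0; the connecting map raises
    degrees by one, whence [d.-1]. *)
Lemma koszul_vanish_cap I J d : ideal I -> ideal J ->
  koszul_vanish I d -> koszul_vanish J d -> koszul_vanish (ideal_add I J) d.-1 ->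
  koszul_vanish (fun f => I f /\ J f) d.
Proof.
move=> hI hJ vI vJ vIJ i c id hc.
have [e1 he1] : kcobound I i c by apply: vI => // B /hc [].
have [e2 he2] : kcobound J i c by apply: vJ => // B /hc [].
case: i id {hc} he1 he2 => [|i] id he1 he2.
  by exists e1 => A hA; move: (he1 _ hA) (he2 _ hA); move/cards0_eq: hA => ->; rewrite !kdiff0.
have id' : (i < d.-1)%N by lia.
have [] := vIJ i (fun A => e1 A - e2 A) id'.
  move=> B hB; exists (- (c B - kdiff e1 B)); first by apply: ideal_opp => //; apply: he1.
  by rewrite kdiffB; have := he2 _ hB; congr J; ring.
move=> w hw.
(* Correcting [e1] by [p], with values in [I], turns a primitive of [c] modulo [I] into a primitive
   modulo both ideals. *)
have [p hp] : exists p, forall A, #|A| = i -> I (p A) /\ J (e1 A - e2 A - kdiff w A - p A).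
  apply: (@exists_choice _ _ (fun A p => #|A| = i -> I p /\ J (e1 A - e2 A - kdiff w A - p))) => A.
  case: (eqVneq #|A| i) => [/hw [r ? ?]|/eqP neq]; first by exists r.
  by exists 0.
exists (fun A => e1 A - p A) => A hA; rewrite kdiffB; split.
  rewrite opprB addrCA addrC; apply: ideal_addr => //; first by apply: he1.
  by apply: kdiff_ideal => // k kA; case: (hp (A :\ k)) => //; apply: card_setD1 kA.
have : J (kdiff (fun B => e1 B - e2 B - kdiff w B - p B) A).
  by apply: kdiff_ideal => // k kA; case: (hp (A :\ k)) => //; apply: card_setD1 kA.
rewrite !kdiffB kdiff_kdiff => /(ideal_opp hJ) /(ideal_addr hJ (he2 _ hA)).
by congr J; ring.
Qed.

(** The next step of the same sequence: H^i(R/(I + J)) lies between the direct sum of H^i(R/I) and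
    H^i(R/J), and H^(i+1)(R/(I n J)). *)
Lemma koszul_vanish_add I J p : ideal I -> ideal J ->
  koszul_vanish (fun f => I f /\ J f) p.+1 -> koszul_vanish I p -> koszul_vanish J p ->
  koszul_vanish (ideal_add I J) p.
Proof.
move=> hI hJ vIJ vI vJ i c ip hc.
have [a ha] : exists a, forall B, #|B| = i.+1 -> I (a B) /\ J (kdiff c B - a B).
  apply: (@exists_choice _ _ (fun B a => #|B| = i.+1 -> I a /\ J (kdiff c B - a))) => A.
  case: (eqVneq #|A| i.+1) => [/hc [r ? ?]|/eqP neq]; first by exists r.
  by exists 0.
have [] := vIJ i.+1 a ip.
  move=> B hB; split.
    by apply: kdiff_ideal => // k kA; case: (ha (B :\ k)) => //; apply: card_setD1 kA.
  have : J (kdiff (fun A => kdiff c A - a A) B).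
    by apply: kdiff_ideal => // k kA; case: (ha (B :\ k)) => //; apply: card_setD1 kA.
  by rewrite kdiffB kdiff_kdiff sub0r => /(ideal_opp hJ); rewrite opprK.
move=> e he.
have [w1 hw1] : kcobound I i e.
  apply: vI => // B hB; case: (ha _ hB) => Ia _; case: (he _ hB) => I1 _.
  by have := ideal_sub hI Ia I1; congr I; ring.
have [w2 hw2] : kcobound J i (fun A => c A - e A).
  apply: vJ => // B hB; case: (ha _ hB) => _ J1; case: (he _ hB) => _ J2.
  by rewrite kdiffB; have := ideal_addr hJ J1 J2; congr J; ring.
exists (fun A => w1 A + w2 A) => A hA; exists (e A - kdiff w1 A); first exact: hw1.
by rewrite kdiffD; have := hw2 _ hA; congr J; ring.
Qed.

Lemma koszul_vanish_top d : koszul_vanish (fun=> True) d.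
Proof. by move=> i c _ _; exists c. Qed.

End Koszul.

(** [u] and [v] exhibit the Koszul complex of R/J as a direct summand of that of R'/I. They are
    additive and only intertwine [y i] with [z i], which allows the substitution of powers for
    variables. *)
Lemma koszul_vanish_retract (n : nat) (R R' : comNzRingType) (y : 'I_n -> R) (z : 'I_n -> R')
    (J : R -> Prop) (I : R' -> Prop) (u : {additive R -> R'}) (v : {additive R' -> R}) d :
  (forall i f, u (y i * f) = z i * u f) -> (forall i f, v (z i * f) = y i * v f) ->
  (forall f, v (u f) = f) -> (forall f, J f -> I (u f)) -> (forall f, I f -> J (v f)) ->
  koszul_vanish z I d -> koszul_vanish y J d.
Proof.
move=> uM vM uK uJ vI h i c id hc.
have uD e B : kdiff z (fun A => u (e A)) B = u (kdiff y e B).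
  by rewrite /kdiff raddf_sum; apply: eq_bigr => k _; rewrite -uM /ksgn raddfMsign.
have vD e B : kdiff y (fun A => v (e A)) B = v (kdiff z e B).
  by rewrite /kdiff raddf_sum; apply: eq_bigr => k _; rewrite -vM /ksgn raddfMsign.
have [|e he] := h i (fun A => u (c A)) id; first by move=> B /hc; rewrite uD; apply: uJ.
exists (fun A => v (e A)) => A hA.
by rewrite vD -[c A]uK -raddfB; apply: vI; apply: he.
Qed.

(** * Noetherianity and regular elements *)

Section Colon.
Variable R : comNzRingType.
Implicit Types I J P : R -> Prop.

Definition colon J g : R -> Prop := fun f => J (f * g).

Lemma colon_ideal J g : ideal J -> ideal (colon J g).
Proof.
move=> hJ; split; rewrite /colon.
- by rewrite mul0r; apply: ideal_zero.
- by move=> a b ha hb; rewrite mulrDl; apply: ideal_addr.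
- by move=> a b hb; rewrite -mulrA; apply: ideal_mull.
Qed.

Lemma colon_mul J g a : ideal J -> prime_ideal (colon J g) -> ~ J (a * g) ->
  colon J g = colon J (a * g).
Proof.
move=> hJ [_ _ pr] na; apply: pred_ext => x; rewrite /colon; split.
  by move=> hx; rewrite mulrCA; apply: ideal_mull.
by rewrite mulrA => /pr[] // /na.
Qed.

Lemma prime_idealX P f k : prime_ideal P -> P (f ^+ k) -> P f.
Proof.
move=> [hP P1 Pm]; elim: k => [|k IH]; first by rewrite expr0.
by rewrite exprS => /Pm [].
Qed.

Lemma prime_ideal_prod P (T : eqType) (r : seq T) (F : T -> R) : prime_ideal P ->
  P (\prod_(i <- r) F i) -> exists2 i, i \in r & P (F i).
Proof.
move=> [hP P1 Pm]; elim: r => [|i r IH]; first by rewrite big_nil.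
rewrite big_cons => /Pm[]; first by exists i; rewrite ?mem_head.
by case/IH => j jr Pj; exists j; rewrite // inE jr orbT.
Qed.

(** [t] is an element of [m] outside [P] times one element outside [P] from each [Q] not contained
    in [P]; primality keeps the product outside [P]. *)
Lemma avoid_one P (m : R -> Prop) (L : list (R -> Prop)) : prime_ideal P -> ideal m ->
  (exists2 f, m f & ~ P f) ->
  exists t, [/\ m t, ~ P t &
    forall Q, List.In Q L -> ideal Q -> (exists2 q, Q q & ~ P q) -> Q t].
Proof.
move=> [hP P1 Pm] hm [f mf Pf]; elim: L => [|Q L [t [mt Pt ht]]]; first by exists f.
case: (classic (exists2 q, Q q & ~ P q)) => [[q Qq Pq]|hq].
  exists (q * t); split; first exact: ideal_mull.
    by case/Pm.
  move=> Q' [<- hQ _|Q'L hQ' hq']; first exact: (ideal_mulr t hQ Qq).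
  by apply: ideal_mull => //; apply: ht.
by exists t; split=> // Q' [<-|] //; apply: ht.
Qed.

(* Adding to s a multiple of everything not contained in P repairs P without
   spoiling the other primes, the ones inside P being taken care of by P. *)
Lemma prime_avoidance (m : R -> Prop) (L : list (R -> Prop)) : ideal m ->
  exists2 s, m s &
    forall P, List.In P L -> prime_ideal P -> (exists2 f, m f & ~ P f) -> ~ P s.
Proof.
move=> hm; elim: L => [|P L [s ms hs]]; first by exists 0 => //; apply: ideal_zero.
case: (classic (prime_ideal P /\ (exists2 f, m f & ~ P f))) => [[pP mP]|bad]; last first.
  exists s => // Q [<- pP mP|]; first by case: bad.
  exact: hs.
case: (classic (P s)) => [Ps|nPs]; last first.
  by exists s => // Q [<-|] //; apply: hs.
have [t [mt Pt ht]] := avoid_one L pP hm mP.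
have hP : ideal P by case: pP.
have nP : ~ P (s + t) by move=> /(ideal_sub)/(_ Ps); rewrite addrC addKr => /(_ hP).
exists (s + t); first exact: ideal_addr.
move=> Q [<- //|QL pQ mQ Qst].
have hQ : ideal Q by case: pQ.
case: (classic (exists2 q, Q q & ~ P q)) => [hq|hq].
  apply: (hs Q) => //; have := ideal_sub hQ Qst (ht Q QL hQ hq).
  by rewrite addrK.
by apply: nP; apply: NNPP => nP; apply: hq; exists (s + t).
Qed.

End Colon.

(** Treating one coordinate at a time, pass to a subsequence along which every exponent is
    nondecreasing; its first two terms are comparable. *)
Lemma dickson n (u : nat -> 'X_{1..n}) : exists i j, (i < j)%N /\ (u i <= u j)%MM.
Proof.
have incr (f : nat -> nat) : exists2 phi : nat -> nat,
    (forall a b, (a < b)%N -> (phi a < phi b)%N) &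
    (forall a b, (a <= b)%N -> (f (phi a) <= f (phi b))%N).
  (* An index whose value is minimal among all later ones; iterating this choice yields the
     subsequence. *)
  have good N : exists i, (N <= i)%N /\ forall j, (i <= j)%N -> (f i <= f j)%N.
    have [k] := ubnP (f N); elim: k N => [|k IH] N //.
    move=> fN; case: (classic (exists2 j, (N <= j)%N & (f j < f N)%N)) => [[j Nj fj]|h].
      have [|i [ji hi]] := IH j; first by lia.
      by exists i; split; [lia|].
    exists N; split=> // j Nj; rewrite leqNgt; apply/negP => fj.
    by apply: h; exists j.
  have [g hg] := exists_choice good.
  pose phi := fix phi k := if k is k'.+1 then g (phi k').+1 else g 0%N.
  have phiS k : (phi k < phi k.+1)%N by have [] := hg (phi k).+1.
  have phiP k : forall j, (phi k <= j)%N -> (f (phi k) <= f j)%N.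
    by case: k => [|k]; [have [] := hg 0%N|have [] := hg (phi k).+1].
  have mono a b : (a < b)%N -> (phi a < phi b)%N.
    elim: b => [//|b IH]; rewrite ltnS leq_eqVlt => /orP[/eqP->|/IH h]; first exact: phiS.
    exact: ltn_trans h (phiS b).
  exists phi => // a b; rewrite leq_eqVlt => /orP[/eqP-> //|/mono h].
  by apply: phiP; apply: ltnW.
have [phi hphi hmon] : exists2 phi : nat -> nat,
    (forall a b, (a < b)%N -> (phi a < phi b)%N) &
    (forall i, i \in enum 'I_n -> forall a b, (a <= b)%N -> (u (phi a) i <= u (phi b) i)%N).
  elim: (enum 'I_n) => [|i s [phi h1 h2]]; first by exists id.
  have [psi g1 g2] := incr (fun k => u (phi k) i).
  exists (phi \o psi) => [a b /g1 /h1 //|j]; rewrite inE => /orP[/eqP->|js] a b ab.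
    exact: g2.
  apply: h2 => //; move: ab; rewrite leq_eqVlt => /orP[/eqP-> //|/g1]; exact: ltnW.
exists (phi 0%N), (phi 1%N); split; first exact: hphi.
by apply/mnm_lepP => i; apply: hmon; rewrite ?mem_enum.
Qed.

Section Noetherian.
Variables (n : nat) (K : fieldType).
Local Notation S := {mpoly K[n]}.
Implicit Types I J P m : S -> Prop.

(** One step of the division algorithm: the multiple of [f] that is subtracted has the same leading
    term as [g]. *)
Lemma mlead_reduce (f g : S) : f != 0 -> (mlead f <= mlead g)%MM -> g != 0 ->
  let q := g - (mleadc g / mleadc f) *: 'X_[mlead g - mlead f] * f in
  q = 0 \/ (mlead q < mlead g)%O.
Proof.
move=> f0 fg g0 q; case: (eqVneq q 0) => [|q0]; [by left|right].
pose p := (mleadc g / mleadc f) *: 'X_[mlead g - mlead f] : S.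
have cf : mleadc f != 0 by rewrite mleadc_eq0.
have cg : mleadc g != 0 by rewrite mleadc_eq0.
have c0 : mleadc g / mleadc f != 0 by rewrite mulf_neq0 ?invr_eq0.
have lp : mlead p = (mlead g - mlead f)%MM by rewrite mleadZ // mleadXm.
have p0 : p != 0.
  apply/eqP => p0; have := mleadc_eq0 p; rewrite p0 eqxx -p0 lp mcoeffZ mcoeffX eqxx mulr1.
  by rewrite (negbTE c0).
have lpf : mlead (p * f) = mlead g by rewrite mleadM // lp submK.
have cpf : (p * f)@_(mlead g) = mleadc g.
  have := mleadcM p f; rewrite -mleadM // lpf lp => ->.
  by rewrite mcoeffZ mcoeffX eqxx mulr1 divfK.
have le : (mlead q <= mlead g)%O.
  by apply: (le_trans (mleadB_le _ _)); rewrite lpf leUx lexx.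
rewrite lt_neqAle le andbT; apply/eqP => e.
have := mleadc_eq0 q; rewrite e mcoeffB cpf subrr eqxx (negbTE q0).
by [].
Qed.

(** In a strict chain, take [F k] in the difference of [I k.+1] and [I k] with least leading
    monomial. By Dickson's lemma the leading monomial of some [F i] divides that of a later [F j];
    reducing [F j] by [F i] contradicts minimality. *)
Lemma mpoly_noetherian (I : nat -> S -> Prop) : (forall k, ideal (I k)) ->
  (forall k f, I k f -> I k.+1 f) -> exists k, forall f, I k.+1 f -> I k f.
Proof.
move=> hI inc; apply: NNPP => no.
have step k : exists f, [/\ I k.+1 f, ~ I k f &
    forall g, I k.+1 g -> ~ I k g -> ~ (mlead g < mlead f)%O].
  apply: NNPP => nk; apply: no; exists k => f; elim/mleadrect: f => f IH If.
  apply: NNPP => nf; apply: nk; exists f; split=> // g Ig ng lt.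
  by apply: ng; apply: IH.
have [F hF] := exists_choice step.
have [i [j [ij le]]] := dickson (fun k => mlead (F k)).
have [Ii ni _] := hF i; have [Ij nj minj] := hF j.
have mono a b f : (a <= b)%N -> I a f -> I b f.
  elim: b => [|b IH]; first by rewrite leqn0 => /eqP->.
  by rewrite leq_eqVlt => /orP[/eqP-> //|/IH h] /h; apply: inc.
have nz k : F k != 0.
  by apply/eqP => e; have [_ + _] := hF k; rewrite e; apply; apply: ideal_zero.
have {}Ii : I j (F i) by apply: mono Ii.
have := mlead_reduce (nz i) le (nz j).
set q := _ - _; have nq : ~ I j q.
  by move=> /(ideal_addr (hI j)) h; apply: nj; rewrite -[F j](subrK ((mleadc (F j) / mleadc (F i)) *: 'X_[mlead (F j) - mlead (F i)] * F i)); apply: h; apply: ideal_mull.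
case=> [q0|]; first by apply: nq; rewrite q0; apply: ideal_zero.
apply: minj => //; apply: ideal_sub => //; apply: ideal_mull => //.
exact: inc.
Qed.

(** Noetherian induction: otherwise every counterexample could be enlarged to another, giving a
    strictly ascending chain. *)
Lemma ideal_ind (P : (S -> Prop) -> Prop) :
  (forall J, ideal J -> (forall J', ideal J' -> (forall f, J f -> J' f) ->
      (exists2 f, J' f & ~ J f) -> P J') -> P J) ->
  forall J, ideal J -> P J.
Proof.
move=> step J0 hJ0; apply: NNPP => nP.
pose bad := {J : S -> Prop | ideal J /\ ~ P J}.
have next (x : bad) : exists z : bad, (forall f, sval x f -> sval z f) /\
    exists2 f, sval z f & ~ sval x f.
  case: x => J [hJ nJ] /=; apply: NNPP => no; apply: nJ; apply: step => // J' hJ' sub ex.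
  apply: NNPP => nJ'; apply: no.
  by exists (exist _ J' (conj hJ' nJ')).
have [g hg] := exists_choice next.
pose I k := iter k g (exist _ J0 (conj hJ0 nP) : bad).
have [|k f|k hk] := @mpoly_noetherian (fun k => sval (I k)).
- by move=> k; case: (I k) => J [].
- by have [] := hg (I k) => h _; apply: h.
by have [_ [f /hk]] := hg (I k).
Qed.

(** If [colon J (r * f)] is proper but not prime, with [a * b] in it and [a], [b] outside, then
    [colon J (a * r * f)] is proper and strictly larger, as it contains [b]. Noetherian induction
    ends this process. *)
Lemma assoc_exists J f : ideal J -> ~ J f ->
  exists2 r, ~ J (r * f) & prime_ideal (colon J (r * f)).
Proof.
move=> hJ nf.
suff H : forall Q, ideal Q -> forall r, Q = colon J (r * f) -> ~ J (r * f) ->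
    exists2 r, ~ J (r * f) & prime_ideal (colon J (r * f)).
  apply: (H _ (colon_ideal f hJ) 1); rewrite mul1r //.
apply: (@ideal_ind (fun Q => forall r, Q = colon J (r * f) -> ~ J (r * f) ->
    exists2 r, ~ J (r * f) & prime_ideal (colon J (r * f)))).
move=> Q hQ IH r eQ nr.
case: (classic (prime_ideal (colon J (r * f)))) => [pr|npr]; first by exists r.
have [a [b [Jab na nb]]] : exists a b, [/\ colon J (r * f) (a * b),
    ~ colon J (r * f) a & ~ colon J (r * f) b].
  apply: NNPP => no; apply: npr; split; first exact: colon_ideal.
    by rewrite /colon mul1r.
  move=> a b ab; apply: NNPP => nab; apply: no; exists a, b; split=> //.
    by move=> h; apply: nab; left.
  by move=> h; apply: nab; right.
have e : a * r * f = a * (r * f) by rewrite mulrA.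
apply: (IH (colon J (a * r * f)) (colon_ideal _ hJ)) (a * r) erefl _.
- by move=> g; rewrite eQ /colon e [g * (a * _)]mulrCA => /(ideal_mull a hJ).
- exists b; first by rewrite /colon e mulrCA mulrA.
  by rewrite eQ.
by rewrite e.
Qed.

(** Choose [h] with J : h prime. If a multiple of [g] outside [J] is congruent to a multiple of [h],
    then J : g = J : h. Otherwise J : g = (J + (h)) : g, and the induction hypothesis applies to J +
    (h). *)
Lemma assoc_finite J : ideal J ->
  exists L : list (S -> Prop), forall g, prime_ideal (colon J g) -> List.In (colon J g) L.
Proof.
move: J; apply: ideal_ind => J hJ IH.
case: (classic (exists f, ~ J f)) => [[f nf]|all]; last first.
  exists nil => g [_ n1 _]; case: n1; apply: NNPP => n1.
  by apply: all; exists (1 * g).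
have [r nr pr] := assoc_exists hJ nf; set h := r * f in nr pr.
have [||L hL] := IH _ (ideal_adjoinP h hJ); first by move=> *; apply: ideal_adjoin_sub.
  by exists h => //; apply: ideal_adjoin_gen.
exists (cons (colon J h) L) => g pg.
have ng : ~ J g by case: pg; rewrite /colon mul1r.
case: (classic (exists a b, J (a * g - b * h) /\ ~ J (a * g))) => [[a [b [Jab nag]]]|no].
  have nbh : ~ J (b * h).
    by move=> h1; apply: nag; apply: (@ideal_subl _ J (a * g) (b * h)).
  left; rewrite (colon_mul hJ pr nbh) (colon_mul hJ pg nag); apply: pred_ext => x.
  have := ideal_mull x hJ Jab; rewrite /colon mulrBr => Jx; split=> hx.
    by have := ideal_addr hJ Jx hx; rewrite subrK.
  by have := ideal_sub hJ hx Jx; rewrite subKr.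
right; have E : colon (ideal_adjoin J h) g = colon J g.
  apply: pred_ext => x; split; last exact: (@ideal_adjoin_sub _ J).
  by case=> b hb; apply: NNPP => nx; apply: no; exists x, b; split.
by rewrite -E; apply: hL; rewrite E.
Qed.

(** When no nonzero class is killed by [m], no associated prime contains [m], and prime avoidance
    gives an [s] outside all of them. *)
Lemma regular_exists m J : ideal m -> ideal J ->
  (forall g, (forall f, m f -> J (f * g)) -> J g) -> exists2 s, m s & regular_mod J s.
Proof.
move=> hm hJ hJm; have [L hL] := assoc_finite hJ.
have [s ms hs] := prime_avoidance L hm; exists s => // g Jsg; apply: NNPP => ng.
have [r nr pr] := assoc_exists hJ ng.
apply: (hs _ (hL _ pr) pr); last by rewrite /colon mulrCA; apply: ideal_mull.
apply: NNPP => no; apply: nr; apply: hJm => f mf; apply: NNPP => nf.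
by apply: no; exists f.
Qed.

End Noetherian.

(** * Depth, Koszul cohomology and monomial ideals *)

Section RegularSeq.
Variable R : comNzRingType.
Implicit Types (I J m : R -> Prop) (s : seq R).

Lemma gen_ideal_ideal (A : R -> Prop) : ideal (gen_ideal A).
Proof.
split.
- by move=> J hJ _; apply: ideal_zero.
- by move=> f g hf hg J hJ hA; apply: ideal_addr; [|apply: hf|apply: hg].
- by move=> f g hg J hJ hA; apply: ideal_mull => //; apply: hg.
Qed.

Lemma gen_ideal_gen (A : R -> Prop) a : A a -> gen_ideal A a.
Proof. by move=> Aa J _; apply. Qed.

Lemma ideal_plus_nil I : ideal I -> ideal_plus I [::] = I.
Proof.
move=> hI; apply: pred_ext => f; split=> [h|If]; first by apply: h => // g [].
by apply: gen_ideal_gen; left.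
Qed.

Lemma ideal_plus_cons I a s : ideal I ->
  ideal_plus I (a :: s) = ideal_plus (ideal_adjoin I a) s.
Proof.
move=> hI; apply: pred_ext => f; split=> h J hJ hA; apply: h => // g.
  case=> [Ig|]; first by apply: hA; left; apply: ideal_adjoin_sub.
  rewrite inE => /orP[/eqP->|gs]; last by apply: hA; right.
  by apply: hA; left; apply: ideal_adjoin_gen.
case=> [[r hr]|gs]; last by apply: hA; right; rewrite inE gs orbT.
apply: (@ideal_subl _ J _ (r * a)) => //; last by apply: hA; left.
by apply: ideal_mull => //; apply: hA; right; apply: mem_head.
Qed.

Lemma regular_seq_cons I a s : ideal I ->
  regular_seq I (a :: s) <-> regular_mod I a /\ regular_seq (ideal_adjoin I a) s.
Proof.
move=> hI; split.
  case=> h1 h2; split; last split.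
  - by move=> g; have := h1 0%N isT g; rewrite /= ideal_plus_nil.
  - by move=> i lt g; have := h1 i.+1 lt g; rewrite /= ideal_plus_cons.
  - by rewrite -ideal_plus_cons.
case=> h1 [h2 h3]; split; last by rewrite ideal_plus_cons.
case=> [_ g|i lt g]; first by rewrite /= ideal_plus_nil //; apply: h1.
by rewrite /= ideal_plus_cons //; apply: h2.
Qed.

Lemma regular_seq_nil I : ideal I -> regular_seq I [::] <-> ~ I 1.
Proof. by move=> hI; rewrite /regular_seq ideal_plus_nil //; split=> [[]|]. Qed.

(** Each term of the sequence raises the range of vanishing by one. The exponent [N] is uniform in
    [J] because the ideal grows along the sequence. *)
Lemma koszul_vanish_regular n (y : 'I_n -> R) m I s : ideal I ->
  (forall f, m f -> exists N, forall J, ideal J -> knull y J (f ^+ N)) ->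
  (forall f, f \in s -> m f) -> regular_seq I s -> koszul_vanish y I (size s).
Proof.
move=> hI hm; elim: s I hI => [|a s IH] I hI sm //.
move/(regular_seq_cons _ _ hI) => [ra rs].
have [N hN] := hm a (sm a (mem_head _ _)).
apply: (@koszul_vanish_of_adjoin _ _ _ _ a N) => //; first exact: hN.
by apply: IH rs => [|f fs]; [apply: ideal_adjoinP|apply: sm; rewrite inE fs orbT].
Qed.

End RegularSeq.

(** H^0 = 0 says that no nonzero class of S/I is killed by the variables, so [m] contains a regular
    element; adjoining it shortens the range of vanishing by one. *)
Lemma regular_seq_exists n (K : fieldType) (m I : {mpoly K[n]} -> Prop) d :
  ideal m -> ~ m 1 -> (forall i, m 'X_i) -> ideal I -> (forall f, I f -> m f) ->
  koszul_vanish (fun i => 'X_i) I d ->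
  exists s, [/\ size s = d, forall f, f \in s -> m f & regular_seq I s].
Proof.
move=> hm m1 mX; elim: d I => [|d IH] I hI Im hv.
  by exists [::]; split=> //; apply/regular_seq_nil => // /Im.
have [g hg|a ma ra] := regular_exists hm hI.
  have [|e he] := hv 0%N (fun=> g) isT.
    move=> B /eqP/cards1P[i ->]; rewrite /kdiff big_set1.
    by apply: ideal_mull => //; apply: hg.
  by have := he set0 (cards0 _); rewrite kdiff0 subr0.
have hI' := ideal_adjoinP a hI.
have Im' f : ideal_adjoin I a f -> m f.
  by case=> r /Im; apply: ideal_subl => //; apply: ideal_mull.
have [s [sz sm rs]] := IH _ hI' Im' (koszul_vanish_adjoin hI ra hv).
exists (a :: s); split; first by rewrite /= sz.
  by move=> f; rewrite inE => /orP[/eqP->|/sm].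
exact/regular_seq_cons.
Qed.

Definition asbool (P : Prop) : bool := if excluded_middle_informative P then true else false.

Lemma asboolP P : reflect P (asbool P).
Proof. by rewrite /asbool; case: excluded_middle_informative => h; constructor. Qed.

(** * Linear maps prescribed on monomials *)

Section LinearExtension.
Variables (n : nat) (K : fieldType) (V : lmodType K) (h : 'X_{1..n} -> V).

Definition mlin (f : {mpoly K[n]}) : V := \sum_(u <- msupp f) f@_u *: h u.

Lemma mlinE (r : seq 'X_{1..n}) f : uniq r -> {subset msupp f <= r} ->
  mlin f = \sum_(u <- r) f@_u *: h u.
Proof.
move=> ur sub; rewrite /mlin [RHS](bigID (mem (msupp f))) /= [X in _ + X]big1 ?addr0.
  rewrite -[RHS]big_filter; apply: perm_big; apply: uniq_perm => [||u].
  - exact: msupp_uniq.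
  - exact: filter_uniq.
  - by rewrite mem_filter; case: (boolP (u \in msupp f)) => //= /sub ->.
by move=> u /memN_msupp_eq0 ->; rewrite scale0r.
Qed.

Fact mlin_is_linear : linear mlin.
Proof.
move=> a f g; pose r := undup (msupp (a *: f + g) ++ msupp f ++ msupp g).
have ur : uniq r by apply: undup_uniq.
rewrite !(@mlinE r) //; try by move=> u hu; rewrite mem_undup !mem_cat hu ?orbT.
rewrite scaler_sumr -big_split; apply: eq_bigr => u _ /=.
by rewrite mcoeffD mcoeffZ scalerDl scalerA.
Qed.

HB.instance Definition _ := GRing.isLinear.Build K {mpoly K[n]} V _ mlin mlin_is_linear.

Lemma mlinX u : mlin 'X_[u] = h u.
Proof. by rewrite /mlin msuppX big_seq1 mcoeffX eqxx scale1r. Qed.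

End LinearExtension.

Lemma mpoly_linear_ext n (K : fieldType) (V : lmodType K) (a b : {linear {mpoly K[n]} -> V}) :
  (forall u, a 'X_[u] = b 'X_[u]) -> forall f, a f = b f.
Proof.
move=> e f; rewrite [f]mpolyE !linear_sum; apply: eq_bigr => u _.
by rewrite !linearZ_LR /= e.
Qed.

Lemma mul_mlin n (K : fieldType) (a f : {mpoly K[n]}) :
  a * f = mlin (fun u => a * 'X_[u]) f.
Proof.
by rewrite /mlin {1}[f]mpolyE mulr_sumr; apply: eq_bigr => u _; rewrite scalerAr.
Qed.

(** * Monomial ideals as sets of exponents, and their depth *)

Section MonomialIdeals.
Variables (n : nat) (K : fieldType).
Local Notation S := {mpoly K[n]}.
Implicit Types (M N : 'X_{1..n} -> Prop) (f g : S).

Definition upset M : Prop := forall u v, M u -> M (u + v)%MM.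

Definition mon_ideal M f : Prop := forall u, u \in msupp f -> M u.

Lemma mon_ideal_mul M1 M2 M f g : (forall u v, M1 u -> M2 v -> M (u + v)%MM) ->
  mon_ideal M1 f -> mon_ideal M2 g -> mon_ideal M (f * g).
Proof.
move=> h hf hg u /msuppM_le /allpairsP[[v w] /= [vf wg ->]].
by apply: h; [apply: hf|apply: hg].
Qed.

Lemma mon_ideal_sub M N f : (forall u, M u -> N u) -> mon_ideal M f -> mon_ideal N f.
Proof. by move=> h hf u /hf /h. Qed.

Lemma mon_ideal_add M f g : mon_ideal M f -> mon_ideal M g -> mon_ideal M (f + g).
Proof. by move=> hf hg u /msuppD_le; rewrite mem_cat => /orP[/hf|/hg]. Qed.

Lemma mon_idealP M : upset M -> ideal (mon_ideal M).
Proof.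
move=> hM; split; [by move=> u; rewrite msupp0| |].
  by move=> f g; apply: mon_ideal_add.
move=> f g; apply: (@mon_ideal_mul (fun=> True)) => // u v _.
by rewrite addmC; apply: hM.
Qed.

Lemma mon_idealX M u : mon_ideal M 'X_[u] <-> M u.
Proof.
by rewrite /mon_ideal msuppX; split=> [|h v]; [apply; apply: mem_head|rewrite inE => /eqP->].
Qed.

Lemma mon_idealMX M f u : mon_ideal M (f * 'X_[u]) <-> mon_ideal (fun v => M (u + v)%MM) f.
Proof.
rewrite /mon_ideal; split=> h v hv.
  by apply: h; rewrite (perm_mem (msuppMX _ _)) map_f.
by move: hv; rewrite (perm_mem (msuppMX _ _)) => /mapP[w /h ? ->].
Qed.

Lemma mon_ideal_min M (J : S -> Prop) f : ideal J -> (forall u, M u -> J 'X_[u]) ->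
  mon_ideal M f -> J f.
Proof.
move=> hJ hM hf; rewrite [f]mpolyE big_seq; apply: ideal_sum => // u /hf Mu.
by rewrite -mul_mpolyC; apply: ideal_mull => //; apply: hM.
Qed.

Lemma mon_ideal_mlin M (h : 'X_{1..n} -> S) f :
  (forall u, u \in msupp f -> mon_ideal M (h u)) -> mon_ideal M (mlin h f).
Proof.
move=> hM; rewrite /mlin big_seq; apply: big_ind => [u|? ? ? ?|u uf].
- by rewrite msupp0.
- exact: mon_ideal_add.
- by move=> v /msuppZ_le; apply: hM.
Qed.

Lemma mon_ideal_cap M N :
  mon_ideal (fun u => M u /\ N u) = (fun f => mon_ideal M f /\ mon_ideal N f).
Proof.
apply: pred_ext => f; split; first by move=> h; split=> u /h [].
by case=> h1 h2 u hu; split; [apply: h1|apply: h2].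
Qed.

Definition mfilter (P : pred 'X_{1..n}) : S -> S :=
  mlin (fun u => if P u then 'X_[u] else 0).

Lemma mcoeff_mfilter P f u : (mfilter P f)@_u = if P u then f@_u else 0.
Proof.
rewrite /mfilter /mlin raddf_sum /=.
case: (boolP (u \in msupp f)) => uf; last first.
  rewrite (memN_msupp_eq0 uf) if_same big_seq big1 // => v vf; rewrite mcoeffZ.
  case: ifP; rewrite ?mcoeff0 ?mulr0 // mcoeffX.
  by rewrite (negbTE (_ : v != u)) ?mulr0 //; apply: contraNneq uf => <-.
rewrite (bigD1_seq u) ?msupp_uniq //= big1 ?addr0 => [|v vu].
  by rewrite mcoeffZ; case: ifP; rewrite ?mcoeff0 ?mulr0 // mcoeffX eqxx mulr1.
by rewrite mcoeffZ; case: ifP; rewrite ?mcoeff0 ?mulr0 // mcoeffX (negbTE vu) mulr0.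
Qed.

Lemma msupp_mfilter P f u : (u \in msupp (mfilter P f)) = P u && (u \in msupp f).
Proof. by rewrite !mcoeff_msupp mcoeff_mfilter; case: (P u); rewrite ?eqxx. Qed.

Lemma msupp_mfilterN P f u : (u \in msupp (f - mfilter P f)) = ~~ P u && (u \in msupp f).
Proof.
rewrite !mcoeff_msupp mcoeffB mcoeff_mfilter; case: (P u); rewrite ?subr0 //.
by rewrite subrr eqxx.
Qed.

Lemma mon_ideal_addE M N :
  ideal_add (mon_ideal M) (mon_ideal N) = mon_ideal (fun u => M u \/ N u).
Proof.
apply: pred_ext => f; split.
  case=> a ha hb; rewrite -[f](subrK a); apply: mon_ideal_add.
    by apply: mon_ideal_sub hb; right.
  by apply: mon_ideal_sub ha; left.
move=> hf; exists (mfilter (fun u => asbool (M u)) f) => u.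
  by rewrite msupp_mfilter => /andP[/asboolP].
by rewrite msupp_mfilterN => /andP[/asboolP nM /hf []].
Qed.

Lemma mnm_split_var (u : 'X_{1..n}) i k : (k <= u i)%N ->
  'X_[u] = 'X_[(u - U_(i) *+ k)%MM] * 'X_i ^+ k :> S.
Proof.
move=> ku; rewrite mpolyXn -mpolyXD; congr 'X_[_].
apply/mnmP => j; rewrite !mnmDE mnmBE mulmnE mnm1E.
by case: eqP => [<-|_]; rewrite ?mul1n ?mul0n ?subn0 ?addn0 // subnK.
Qed.

Lemma mon_ideal_adjoin M i : upset M ->
  ideal_adjoin (mon_ideal M) 'X_i = mon_ideal (fun u => M u \/ (0 < u i)%N).
Proof.
move=> hM.
have hN : upset (fun u => M u \/ (0 < u i)%N).
  by move=> u v [/hM|h]; [left|right; rewrite mnmDE ltn_addr].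
apply: pred_ext => f; split.
  case=> r hr; rewrite -[f](subrK (r * 'X_i)); apply: mon_ideal_add.
    by apply: mon_ideal_sub hr; left.
  by apply: (ideal_mull r (mon_idealP hN)); apply/mon_idealX; right; rewrite mnm1E eqxx.
apply: mon_ideal_min; first exact/ideal_adjoinP/mon_idealP.
move=> u [Mu|ui]; first by apply: ideal_adjoin_sub; apply/mon_idealX.
exists 'X_[(u - U_(i))%MM]; rewrite (@mnm_split_var u i 1) // expr1.
by rewrite subrr => v; rewrite msupp0.
Qed.

Lemma regular_mon_ideal M i : (forall u, M (u + U_(i))%MM -> M u) ->
  regular_mod (mon_ideal M) 'X_i.
Proof.
move=> h g; rewrite mulrC => /mon_idealMX; apply: mon_ideal_sub => u.
by rewrite addmC; apply: h.
Qed.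

Lemma var_idealE A : @var_ideal n K A = mon_ideal (fun u => exists2 i, i \in A & (0 < u i)%N).
Proof.
apply: pred_ext => f; split.
  apply; first by apply: mon_idealP => u v [i iA ui]; exists i => //; rewrite mnmDE ltn_addr.
  by move=> _ [i iA ->]; apply/mon_idealX; exists i; rewrite ?mnm1E ?eqxx.
apply: mon_ideal_min; first exact: gen_ideal_ideal.
move=> u [i iA ui]; rewrite (@mnm_split_var u i 1) // expr1.
by apply: (ideal_mull _ (@gen_ideal_ideal _ _)); apply: gen_ideal_gen; exists i.
Qed.

Lemma monomial_idealP I : monomial_ideal I -> exists2 M, upset M & I = mon_ideal M.
Proof.
case=> M hM; pose N u := exists2 v, M v & (v <= u)%MM.
have uN : upset N.
  by move=> u w [v Mv vu]; exists v => //; apply: (lepm_trans vu); apply: lem_addr.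
exists N => //; apply: pred_ext => f; rewrite hM; split.
  apply; first exact: mon_idealP.
  by move=> _ [u Mu ->]; apply/mon_idealX; exists u => //; apply: lepm_refl.
apply: mon_ideal_min; first exact: gen_ideal_ideal.
move=> u [v Mv vu]; rewrite -(submK vu) mpolyXD.
by apply: (ideal_mull _ (@gen_ideal_ideal _ _)); apply: gen_ideal_gen; exists v.
Qed.

Lemma mon_ideal_monomial M : upset M -> monomial_ideal (mon_ideal M).
Proof.
move=> hM; exists M => f; split.
  apply: mon_ideal_min; first exact: gen_ideal_ideal.
  by move=> u Mu; apply: gen_ideal_gen; exists u.
apply; first exact: mon_idealP.
by move=> _ [u Mu ->]; apply/mon_idealX.
Qed.

Lemma mon_idealXn a f k : mon_ideal (fun u => (a <= mdeg u)%N) f ->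
  mon_ideal (fun u => (a * k <= mdeg u)%N) (f ^+ k).
Proof.
move=> hf; elim: k => [|k IH]; first by move=> u _; rewrite muln0.
rewrite exprS; apply: (mon_ideal_mul _ hf IH) => u v hu hv.
by rewrite mdegD mulnS leq_add.
Qed.

Local Notation m := (@var_ideal n K [set: 'I_n]).

Lemma knull_var k f : m f ->
  exists e, forall J, ideal J -> knull (fun i => 'X_i ^+ k : S) J (f ^+ e).
Proof.
(* Pigeonhole: a monomial of degree above [n * k] has an exponent at least [k], hence is a multiple
   of some ['X_i ^+ k]. *)
rewrite var_idealE => hf; exists (n * k).+1 => J hJ.
have : mon_ideal (fun u => (1 <= mdeg u)%N) f.
  apply: mon_ideal_sub hf => u [i _ ui]; rewrite mdegE (bigD1 i) //=.
  by rewrite ltn_addr.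
move/(@mon_idealXn _ _ (n * k).+1); rewrite mul1n.
apply: mon_ideal_min; first exact: knull_ideal.
move=> u hu.
have [i ki] : exists i, (k <= u i)%N.
  apply: NNPP => no; move: hu; rewrite ltnNge mdegE => /negP; apply.
  rewrite -[n in (n * k)%N]card_ord -sum_nat_const; apply: leq_sum => i _.
  by rewrite leqNgt; apply/negP => h; apply: no; exists i; apply: ltnW.
by rewrite (mnm_split_var ki); apply: (ideal_mull _ (@knull_ideal _ _ _ _ hJ)); apply: (@knull_gen n S (fun i => 'X_i ^+ k)).
Qed.

Lemma var_ideal_proper : ~ m 1.
Proof.
rewrite var_idealE => /(_ 0%MM); rewrite msupp1 mem_head => /(_ isT) [i _].
by rewrite mnm0E.
Qed.

Lemma var_ideal_gen i : m 'X_i.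
Proof. by apply: gen_ideal_gen; exists i; rewrite ?inE. Qed.

Lemma mon_ideal_sub_var M f : ~ M 0%MM -> mon_ideal M f -> m f.
Proof.
rewrite var_idealE => M0 hf u /hf Mu; apply: NNPP => no; apply: M0.
rewrite (_ : 0%MM = u) //; apply/mnmP => i; rewrite mnm0E; apply/eqP.
rewrite eq_sym -leqn0 leqNgt; apply/negP => h; apply: no.
by exists i; rewrite ?inE.
Qed.

(** The upper bound may be tested on powers of the variables: by [knull_var], every element of [m]
    has a power annihilating their Koszul cohomology too. *)
Lemma is_depth_koszul M d k : upset M -> ~ M 0%MM ->
  koszul_vanish (fun i => 'X_i : S) (mon_ideal M) d ->
  ~ koszul_vanish (fun i => 'X_i ^+ k : S) (mon_ideal M) d.+1 ->
  is_depth m (mon_ideal M) d.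
Proof.
move=> hM M0 hv nv.
split.
  apply: regular_seq_exists => //.
  - exact: gen_ideal_ideal.
  - exact: var_ideal_proper.
  - exact: var_ideal_gen.
  - exact: mon_idealP.
  - by move=> f; apply: mon_ideal_sub_var.
move=> s sm rs; rewrite leqNgt; apply/negP => lt; apply: nv.
apply: (koszul_vanish_le lt).
apply: koszul_vanish_regular rs; [exact: mon_idealP| |exact: sm].
by move=> f; apply: knull_var.
Qed.

Lemma is_depth_koszulN M d : upset M -> ~ M 0%MM -> is_depth m (mon_ideal M) d ->
  ~ koszul_vanish (fun i => 'X_i : S) (mon_ideal M) d.+1.
Proof.
move=> hM M0 [_ hd] hv.
have subm f : mon_ideal M f -> m f by apply: mon_ideal_sub_var.
have [s [sz sm rs]] := regular_seq_exists (@gen_ideal_ideal _ _) var_ideal_proper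
  var_ideal_gen (mon_idealP hM) subm hv.
by have := hd s sm rs; rewrite sz ltnn.
Qed.

(* Substituting x_i^k for x_i and multiplying by (x_1...x_n)^c splits: extract
   the monomials with exponents congruent to c modulo k. *)
Lemma koszul_vanish_dilate M N k c d : (c < k)%N -> 
  (forall u, N u <-> M [multinom (k * u i + c)%N | i < n]) ->
  koszul_vanish (fun i => 'X_i ^+ k : S) (mon_ideal M) d ->
  koszul_vanish (fun i => 'X_i : S) (mon_ideal N) d.
Proof.
move=> ck hNM.
have k0 : (0 < k)%N by apply: leq_ltn_trans ck.
pose up u : S := 'X_[[multinom (k * u i + c)%N | i < n]].
pose dn u : S := if [forall i, u i %% k == c]%N then 'X_[[multinom (u i %/ k)%N | i < n]] else 0.
have mulX i (u : 'X_{1..n}) j : 'X_i ^+ j * 'X_[u] = 'X_[(u + U_(i) *+ j)%MM] :> S.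
  by rewrite mpolyXn -mpolyXD addmC.
have X1 i (f : S) : 'X_i * f = 'X_i ^+ 1 * f by rewrite expr1.
apply: (@koszul_vanish_retract n S S _ _ _ _ (mlin up) (mlin dn)).
- move=> i f; rewrite X1.
  rewrite !mul_mlin -[LHS]/((mlin up \o mlin _) f) -[RHS]/((mlin _ \o mlin up) f).
  apply: mpoly_linear_ext => u /=; rewrite mlinX mulX !mlinX mulX; congr 'X_[_].
  apply/mnmP => j; rewrite mnmE !mnmDE !mulmnE !mnm1E mnmE.
  by case: eqP => _; lia.
- move=> i f; rewrite X1.
  rewrite !mul_mlin -[LHS]/((mlin dn \o mlin _) f) -[RHS]/((mlin _ \o mlin dn) f).
  apply: mpoly_linear_ext => u /=; rewrite mlinX mulX -mul_mlin !mlinX /dn.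
  have eqi : [forall j, (u + U_(i) *+ k)%MM j %% k == c]%N = [forall j, u j %% k == c]%N.
    apply: eq_forallb => j; rewrite mnmDE mulmnE.
    by rewrite addnC modnMDl.
  rewrite eqi; case: ifP => _; last by rewrite mulr0.
  rewrite mulX; congr 'X_[_]; apply/mnmP => j.
  rewrite mnmE !mnmDE !mulmnE !mnm1E mnmE.
  by rewrite addnC divnMDl // muln1 addnC.
- move=> f; rewrite -[LHS]/((mlin dn \o mlin up) f) -[RHS]/((idfun : {linear S -> S}) f).
  apply: mpoly_linear_ext => u /=; rewrite !mlinX /dn ifT.
    congr 'X_[_]; apply/mnmP => j; rewrite !mnmE.
    by rewrite mulnC divnMDl // divn_small // addn0.
  by apply/forallP => j; rewrite mnmE mulnC modnMDl modn_small.
- move=> f hf; apply: mon_ideal_mlin => u uf; apply/mon_idealX/hNM; exact: hf.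
- move=> f hf; apply: mon_ideal_mlin => u uf; rewrite /dn.
  case: ifP => [/forallP hu|_]; last by move=> v; rewrite msupp0.
  apply/mon_idealX/hNM; rewrite (_ : [multinom _ | _ < _] = u); first exact: hf.
  by apply/mnmP => i; rewrite !mnmE -(eqP (hu i)) mulnC -divn_eq.
Qed.

End MonomialIdeals.

(** * Unions of simplices *)

Section Nerve.
Variables (n : nat) (K : fieldType).
Local Notation S := {mpoly K[n]}.
Local Notation var := (fun i : 'I_n => 'X_i : S).
Implicit Types (M N : 'X_{1..n} -> Prop) (G : {set 'I_n}).

Definition koszul_mon M d : Prop := koszul_vanish var (mon_ideal M) d.

(** Mayer-Vietoris peels off one [Q F] at a time, [N] collecting the ideals already added. A sum of
    r of them is reached through r - 1 connecting maps, whence the range [p.+1 - size t]. *)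
Lemma koszul_mon_nerve (T : eqType) (Q : T -> 'X_{1..n} -> Prop) (s : seq T) N p :
  (forall F, upset (Q F)) -> upset N ->
  (forall t, subseq t s -> t != [::] ->
     koszul_mon (fun u => N u \/ exists2 F, F \in t & Q F u) (p.+1 - size t)) ->
  koszul_mon (fun u => N u \/ forall F, F \in s -> Q F u) p.
Proof.
move=> hQ; elim: s N p => [|F s IH] N p hN hs.
  rewrite /koszul_mon (_ : mon_ideal _ = fun=> True); first exact: koszul_vanish_top.
  by apply: pred_ext => f; split=> // _ u _; right.
have hNF : upset (fun u => N u \/ Q F u).
  by move=> u v [/hN|/hQ]; [left|right].
have hNs : upset (fun u => N u \/ forall F, F \in s -> Q F u).
  by move=> u v [/hN|h]; [left|right=> F' /h /hQ].
(* For monomial ideals, sums distribute over intersections. *)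
rewrite /koszul_mon (_ : mon_ideal _ = mon_ideal (fun u =>
    (N u \/ Q F u) /\ (N u \/ forall F, F \in s -> Q F u))); last first.
  congr mon_ideal; apply: pred_ext => u; split.
    case=> [Nu|h]; first by split; left.
    split; right; first by apply: h; apply: mem_head.
    by move=> F' F's; apply: h; rewrite inE F's orbT.
  case=> [[Nu|QF]] [Nu'|h]; try by left.
  by right=> F'; rewrite inE => /orP[/eqP->|/h].
rewrite mon_ideal_cap; apply: koszul_vanish_cap; try exact: mon_idealP.
- have := hs [:: F]; rewrite subn1 /= eqxx => /(_ (sub0seq _) isT).
  congr (koszul_vanish _ (mon_ideal _) _); apply: pred_ext => u; split.
    by case=> [|[F']]; [left|rewrite inE => /eqP-> ?; right].
  by case=> h; [left|right; exists F; rewrite ?mem_head].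
- apply: IH => // t ts t0; apply: hs => //.
  by apply: subseq_trans ts _; apply: subseq_cons.
case: p hs => [|p] hs //.
rewrite mon_ideal_addE (_ : (fun u => _) = (fun u => (N u \/ Q F u) \/ forall F, F \in s -> Q F u)); last first.
  by apply: pred_ext => u; tauto.
apply: IH => // t ts t0; have := hs (F :: t).
rewrite /= eqxx => /(_ ts isT); rewrite subSS.
congr (koszul_vanish _ (mon_ideal _) _); apply: pred_ext => u; split.
  case=> [|[F']]; first by left; left.
  by rewrite inE => /orP[/eqP->|F't] QF; [left; right|right; exists F'].
case=> [[Nu|QF]|[F' F't QF]]; first by left.
  by right; exists F; rewrite ?mem_head.
by right; exists F' => //; rewrite inE F't orbT.
Qed.

(** The variables in [G] form a regular sequence: each is regular modulo [M], and the others stay so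
    once it is adjoined. *)
Lemma koszul_mon_free M G : upset M ->
  (forall i, i \in G -> forall u, M (u + U_(i))%MM -> M u) -> koszul_mon M #|G|.
Proof.
have [k] := ubnP #|G|; elim: k G M => [//|k IH] G M; rewrite ltnS => Gk hM hG.
case: (set_0Vmem G) => [->|[i iG]]; first by rewrite cards0.
have hM' : upset (fun u => M u \/ (0 < u i)%N).
  by move=> u v [/hM|h]; [left|right; rewrite mnmDE ltn_addr].
rewrite (cardsD1 i) iG add1n.
apply: (@koszul_vanish_of_adjoin _ _ _ _ 'X_i 1).
- exact: mon_idealP.
- by apply: regular_mon_ideal; apply: hG.
- by rewrite expr1; apply: (@knull_gen n S var); apply: mon_idealP.
rewrite mon_ideal_adjoin //; apply: IH => //.
  by move: Gk; rewrite (cardsD1 i) iG.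
move=> j /setD1P[ji jG] u [/hG|]; first by left; auto.
by rewrite mnmDE mnm1E (negbTE ji) addn0; right.
Qed.

(** The exponents of the prime P_G = (x_i : i not in G), whose quotient is the polynomial ring on
    [G]. *)
Definition off_face G (u : 'X_{1..n}) : Prop := exists2 i, i \notin G & (0 < u i)%N.

Lemma off_face_upset G : upset (off_face G).
Proof. by move=> u v [i iG ui]; exists i => //; rewrite mnmDE ltn_addr. Qed.

Lemma off_faceI F G : off_face (F :&: G) = (fun u => off_face F u \/ off_face G u).
Proof.
apply: pred_ext => u; split.
  by case=> i; rewrite inE negb_and => /orP[]; [left|right]; exists i.
by case=> [[i iF ui]|[i iF ui]]; exists i => //; rewrite inE negb_and iF ?orbT.
Qed.

Lemma koszul_mon_off_face G : koszul_mon (off_face G) #|G|.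
Proof.
apply: koszul_mon_free; first exact: off_face_upset.
move=> i iG u [j jG]; rewrite mnmDE mnm1E (negbTE (_ : i != j)) ?addn0; first by exists j.
by apply: contraNneq jG => <-.
Qed.

(** Adjoining the variables of [G], each of them regular, reduces to the empty set, where the
    quotient is the base field and H^0 is nonzero. *)
Lemma koszul_mon_off_faceN G : ~ koszul_mon (off_face G) #|G|.+1.
Proof.
have [k] := ubnP #|G|; elim: k G => [//|k IH] G; rewrite ltnS => Gk.
case: (set_0Vmem G) => [->|[i iG]].
  rewrite cards0 => /(_ 0%N (fun=> 1) isT)[].
    move=> B /eqP/cards1P[i ->]; rewrite /kdiff big_set1.
    apply: (ideal_mull _ (@mon_idealP n K _ (@off_face_upset set0))).
    rewrite mulr1; apply/mon_idealX; exists i; first by rewrite inE.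
    by rewrite mnm1E eqxx.
  move=> e /(_ set0 (cards0 _)); rewrite kdiff0 subr0 => /(_ 0%MM).
  by rewrite msupp1 mem_head => /(_ isT) [j _]; rewrite mnm0E.
rewrite (cardsD1 i) iG add1n => h; apply: (IH (G :\ i)).
  by move: Gk; rewrite (cardsD1 i) iG.
have iM : regular_mod (mon_ideal (off_face G)) ('X_i : S).
  apply: regular_mon_ideal => u [j jG].
  rewrite mnmDE mnm1E (negbTE (_ : i != j)) ?addn0; first by exists j.
  by apply: contraNneq jG => <-.
have := koszul_vanish_adjoin (@mon_idealP n K _ (@off_face_upset G)) iM h.
rewrite mon_ideal_adjoin; last exact: off_face_upset.
congr (koszul_vanish _ (mon_ideal _) _); apply: pred_ext => u; split.
  case=> [[j jG uj]|ui]; first by exists j; rewrite // inE negb_and jG orbT.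
  by exists i; rewrite // !inE eqxx.
by case=> j; rewrite !inE negb_and negbK => /orP[/eqP->|jG] uj; [right|left; exists j].
Qed.

(** The prime of this face is the sum of P_G and of the P_F for [F] in [s]. In inductions on [s],
    [G] collects the simplices already intersected. *)
Definition common_face G (s : seq {set 'I_n}) : {set 'I_n} := G :&: \bigcap_(F <- s) F.

Lemma off_face_common G s :
  off_face (common_face G s) = (fun u => off_face G u \/ exists2 F, F \in s & off_face F u).
Proof.
rewrite /common_face off_faceI; apply: pred_ext => u.
suff -> : off_face (\bigcap_(F <- s) F) u <-> exists2 F, F \in s & off_face F u by [].
elim: s => [|F s IH]; first by rewrite big_nil; split=> [[i]|[]]; rewrite ?inE.
rewrite big_cons off_faceI IH; split.
  case=> [h|[F' F's h]]; first by exists F; rewrite ?mem_head.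
  by exists F'; rewrite // inE F's orbT.
case=> F'; rewrite inE => /orP[/eqP->|F's] h; [by left|by right; exists F'].
Qed.

Lemma koszul_mon_simplices G s p :
  (forall t, subseq t s -> t != [::] -> (p <= #|common_face G t| + size t)%N) ->
  koszul_mon (fun u => off_face G u \/ forall F, F \in s -> off_face F u) p.-1.
Proof.
move=> hs; case: p hs => // p hs; apply: koszul_mon_nerve => [F||t ts t0].
- exact: off_face_upset.
- exact: off_face_upset.
rewrite -off_face_common; apply: (koszul_vanish_le _ (@koszul_mon_off_face _)).
by rewrite leq_subLR addnC; apply: hs.
Qed.

(** Split off the first simplex F. Both pieces vanish below [p - 1]; if their intersection vanished
    below [p], Mayer-Vietoris would give vanishing below [p - 1] for their sum. That sum belongs to
    G n F and the remaining simplices, whose minimum is [p - 1], against the induction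
    hypothesis. *)
Lemma koszul_mon_simplicesN G s p : s != [::] -> (#|common_face G s| + size s <= p)%N ->
  (forall t, subseq t s -> t != [::] -> (p <= #|common_face G t| + size t)%N) ->
  ~ koszul_mon (fun u => off_face G u \/ forall F, F \in s -> off_face F u) p.
Proof.
elim: s G p => [//|F s IH] G p _ le hs.
case: (eqVneq s [::]) => [s0|s0] hv.
  apply: (@koszul_mon_off_faceN (common_face G [:: F])).
  have := koszul_vanish_le _ hv => /(_ #|common_face G [:: F]|.+1).
  move: le; rewrite s0 addn1 => le /(_ le).
  rewrite /koszul_mon off_face_common.
  by congr (koszul_vanish _ (mon_ideal _) _); apply: pred_ext => u; split;
    (case=> [|h]; [by left|right]); [exists F; rewrite ?mem_head //; apply: h; apply: mem_head
     | case: h => F'; rewrite inE => /eqP-> ? F''; rewrite inE => /eqP->].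
case: p le hs hv => [|p] le hs hv; first by move: le; rewrite leqn0 addn_eq0 /= andbF.
have consI t : common_face (G :&: F) t = common_face G (F :: t).
  by rewrite /common_face big_cons setIA.
apply: (IH (G :&: F) p s0).
- by rewrite consI; move: le => /=; rewrite addnS ltnS.
- move=> t ts t0; rewrite consI.
  by have := hs (F :: t); rewrite /= eqxx addnS ltnS; apply.
have hI : koszul_mon (off_face (G :&: F)) p.
  have := hs [:: F]; rewrite /= eqxx sub0seq addn1 ltnS /common_face big_seq1.
  by move=> /(_ isT isT) h; apply: (koszul_vanish_le h (@koszul_mon_off_face _)).
have hJ : koszul_mon (fun u => off_face G u \/ forall F, F \in s -> off_face F u) p.
  apply: (@koszul_mon_simplices G s p.+1) => t ts; apply: hs.
  by apply: subseq_trans ts _; apply: subseq_cons.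
have uI : upset (off_face (G :&: F)) by apply: off_face_upset.
have uJ : upset (fun u => off_face G u \/ forall F, F \in s -> off_face F u).
  by move=> u v [/off_face_upset|h]; [left|right=> F' /h /off_face_upset].
have := koszul_vanish_add (mon_idealP K uI) (mon_idealP K uJ) _ hI hJ.
rewrite mon_ideal_addE -mon_ideal_cap /koszul_mon.
rewrite (_ : (fun u => _ \/ (_ \/ _)) = (fun u => off_face (G :&: F) u \/ forall F, F \in s -> off_face F u)); last first.
  by apply: pred_ext => u; rewrite off_faceI; tauto.
apply; rewrite (_ : (fun u => _ /\ _) = (fun u => off_face G u \/ forall F', F' \in F :: s -> off_face F' u)) //.
apply: pred_ext => u; rewrite off_faceI /=; split.
  case=> [[h|h]] [h'|h']; try by left.
  by right=> F'; rewrite inE => /orP[/eqP->|/h'].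
case=> [h|h]; first by split; left.
split; right; first by apply: h; apply: mem_head.
by move=> F' F's; apply: h; rewrite inE F's orbT.
Qed.

End Nerve.

(** * Comparing characteristics *)

Section ScalarComplex.
Variables (n : nat) (V : pred {set 'I_n}).
Local Notation T := #|{set 'I_n}|.

(** With all [y i] equal to 1, [kdiff] is the simplicial coboundary; when [V] contains all sets
    lying between two of its members, this is exactness of a relative cochain complex. *)
Definition scalar_exact (F : fieldType) i : Prop :=
  forall c : {set 'I_n} -> F, (forall A, ~~ V A -> c A = 0) ->
    (forall B, V B -> #|B| = i.+1 -> kdiff (fun=> 1) c B = 0) ->
    exists2 e, (forall A, ~~ V A -> e A = 0) &
      forall A, V A -> #|A| = i -> c A = kdiff (fun=> 1) e A.

(** It acts on row vectors indexed by all subsets, so that matrices of different degrees have the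
    same size. *)
Definition coboundary_mx i : 'M[int]_T := \matrix_(a, b)
  let A := enum_val a in let B := enum_val b in
  if [&& V A, V B & #|B| == i] then \sum_(j in B | B :\ j == A) ksgn int j B else 0.

(** The projection to the coordinates outside degree [i] of [V]; its kernel consists of the cochains
    of degree [i]. *)
Definition off_level_mx i : 'M[int]_T := \matrix_(a, b)
  if (a == b) && ~~ (V (enum_val a) && (#|enum_val a| == i)) then 1 else 0.

Section Field.
Variable F : fieldType.
Implicit Types w : 'rV[F]_T.

Lemma mul_coboundary_mx w i B : (w *m map_mx intr (coboundary_mx i)) 0 (enum_rank B) =
  if V B && (#|B| == i) then
    kdiff (fun=> 1) (fun A => if V A then w 0 (enum_rank A) else 0) B
  else 0.
Proof.
rewrite mxE (reindex (@enum_rank {set 'I_n})) /=; last exact/onW_bij/enum_rank_bij.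
under eq_bigr do rewrite !mxE /= !enum_rankK.
case: ifP => VB; last by rewrite big1 // => A _; rewrite andbF rmorph0 mulr0.
rewrite /kdiff.
transitivity (\sum_A \sum_(j in B | B :\ j == A) ksgn F j B * (if V A then w 0 (enum_rank A) else 0)).
  apply: eq_bigr => A _; rewrite andbT -mulr_suml.
  case: (V A); rewrite ?rmorph0 ?mulr0 // mulrC; congr (_ * _).
  by rewrite rmorph_sum; apply: eq_bigr => j _; rewrite /ksgn rmorph_sign.
rewrite (exchange_big_dep (fun j => j \in B)) /=; last by move=> A j _ /andP[].
apply: eq_bigr => j jB; rewrite (big_pred1 (B :\ j)) ?mul1r // => A.
by rewrite /= jB eq_sym.
Qed.

Lemma mul_off_level_mx w i B : (w *m map_mx intr (off_level_mx i)) 0 (enum_rank B) =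
  if V B && (#|B| == i) then 0 else w 0 (enum_rank B).
Proof.
rewrite mxE (bigD1 (enum_rank B)) //= big1 ?addr0.
  by rewrite !mxE eqxx enum_rankK; case: (V B && _); rewrite /= ?mulr0 ?mulr1.
by move=> a /negbTE aB; rewrite !mxE aB rmorph0 mulr0.
Qed.

Lemma rV_set_eq w1 w2 : (forall B, w1 0 (enum_rank B) = w2 0 (enum_rank B)) -> w1 = w2.
Proof. by move=> h; apply/rowP => a; rewrite -(enum_valK a) h. Qed.

(** The left kernel is the space of cocycles: concentration in degree [i] and vanishing of the
    coboundary are imposed together. *)
Definition cocycle_mx i : 'M[F]_(T, T + T) :=
  row_mx (map_mx intr (off_level_mx i)) (map_mx intr (coboundary_mx i.+1)).

Lemma coboundary_cocycle_mx i : (forall A B C : {set 'I_n}, A \subset B -> B \subset C -> V A -> V C -> V B) ->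
  map_mx intr (coboundary_mx i) *m cocycle_mx i = 0.
Proof.
move=> conv; apply/row_matrixP => a; rewrite row0 rowE; set w := delta_mx _ _.
rewrite mulmxA mul_mx_row.
have -> : w *m map_mx intr (coboundary_mx i) *m map_mx intr (off_level_mx i) = 0.
  apply: rV_set_eq => B; rewrite mul_off_level_mx mul_coboundary_mx [RHS]mxE.
  by case: ifP => // h; rewrite [X in if X then _ else _]h.
have -> : w *m map_mx intr (coboundary_mx i) *m map_mx intr (coboundary_mx i.+1) = 0.
  apply: rV_set_eq => B; rewrite mul_coboundary_mx [RHS]mxE; case: ifP => // /andP[VB /eqP cB].
  rewrite -[RHS](kdiff_kdiff (fun=> 1) (fun A => if V A then w 0 (enum_rank A) else 0) B).
  apply: eq_bigr => j jB; rewrite mul_coboundary_mx (card_setD1 cB jB) eqxx andbT.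
  (* If [B :\ j] is outside [V], so is every [B :\ j :\ k], by convexity and since [B] is in [V]. *)
  case: (boolP (V (B :\ j))) => // VBj; rewrite [kdiff _ _ _]big1 // => k kBj.
  rewrite ifF ?mulr0 //; apply: contraNF VBj => VA.
  by apply: conv VA VB; apply: subD1set.
by rewrite row_mx0.
Qed.

Lemma scalar_exact_kermx i :
  scalar_exact F i <-> (kermx (cocycle_mx i) <= (map_mx intr (coboundary_mx i) : 'M[F]_T))%MS.
Proof.
split=> [ex|ker].
  apply/rV_subP => w /sub_kermxP; rewrite mul_mx_row -row_mx0 => /eq_row_mx[w1 w2].
  have supp B : ~~ (V B && (#|B| == i)) -> w 0 (enum_rank B) = 0.
    by move=> /negbTE nB; have := mul_off_level_mx w i B; rewrite w1 mxE nB.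
  have [||e he1 he2] := ex (fun A => w 0 (enum_rank A)).
  - by move=> A /negbTE nA; apply: supp; rewrite nA.
  - move=> B VB cB; have := mul_coboundary_mx w i.+1 B; rewrite w2 mxE VB cB eqxx /= => ->.
    apply: eq_bigr => j _; congr (_ * (_ * _)); case: ifP => // /negbT nV.
    by apply: supp; rewrite negb_and nV.
  apply/submxP; exists (\row_a e (enum_val a)); apply: rV_set_eq => B.
  rewrite mul_coboundary_mx; case: ifP => [/andP[VB /eqP cB]|/negbT/supp //].
  rewrite he2 //; apply: eq_bigr => j _; congr (_ * (_ * _)).
  by case: ifP => [_|/negbT/he1 //]; rewrite mxE enum_rankK.
move=> c c0 hc; pose ci (A : {set 'I_n}) := if #|A| == i then c A else 0.
pose w : 'rV[F]_T := \row_a ci (enum_val a).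
have wE A : w 0 (enum_rank A) = ci A by rewrite mxE enum_rankK.
have /submxP[z hz] : (w <= (map_mx intr (coboundary_mx i) : 'M[F]_T))%MS.
  apply: submx_trans ker; apply/sub_kermxP; rewrite mul_mx_row -row_mx0; congr row_mx.
    apply: rV_set_eq => B; rewrite mul_off_level_mx wE [RHS]mxE /ci.
    case: ifP => // /negbT; rewrite negb_and => /orP[/c0-> |/negbTE-> //].
    by rewrite if_same.
  apply: rV_set_eq => B; rewrite mul_coboundary_mx [RHS]mxE; case: ifP => // /andP[VB /eqP cB].
  rewrite -[RHS](hc B VB cB); apply: eq_bigr => j jB; congr (_ * (_ * _)).
  rewrite wE /ci (card_setD1 cB jB) eqxx.
  by case: ifP => // /negbT/c0.
exists (fun A => if V A then z 0 (enum_rank A) else 0); first by move=> A /negbTE->.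
move=> A VA cA; have := mul_coboundary_mx z i A.
by rewrite -hz VA cA eqxx wE /ci cA eqxx.
Qed.

End Field.

End ScalarComplex.

(** * Ranks of integer matrices over different fields *)

Lemma mxrank_mxsub (F : fieldType) m p m' p' (f : 'I_m' -> 'I_m) (g : 'I_p' -> 'I_p) (A : 'M[F]_(m, p)) :
  (\rank (mxsub f g A) <= \rank A)%N.
Proof.
rewrite mxsubrc; apply: leq_trans (mxrankS (rowsub_sub _ _)) _.
rewrite -mxrank_tr -[X in (_ <= X)%N]mxrank_tr.
have -> : (colsub g A)^T = rowsub g A^T by apply/matrixP => i j; rewrite !mxE.
exact/mxrankS/rowsub_sub.
Qed.

Lemma full_rank_minor (F : fieldType) m p (A : 'M[F]_(m, p)) :
  exists f : 'I_(\rank A) -> 'I_m, exists g : 'I_(\rank A) -> 'I_p, mxsub f g A \in unitmx.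
Proof.
exists (maxrankfun A).
have full : row_full (rowsub (maxrankfun A) A)^T.
  by rewrite /row_full mxrank_tr; apply: maxrowsub_free.
exists (fullrankfun full); rewrite -unitmx_tr.
have -> : (mxsub (maxrankfun A) (fullrankfun full) A)^T =
    rowsub (fullrankfun full) (rowsub (maxrankfun A) A)^T by apply/matrixP => i j; rewrite !mxE.
exact: fullrowsub_unit.
Qed.

(** A minor that is nonzero over [L] comes from a nonzero integer, which stays nonzero over [K]. *)
Lemma mxrank_intr_le (L K : fieldType) m p (A : 'M[int]_(m, p)) : [pchar K] =i pred0 ->
  (\rank (map_mx intr A : 'M[L]_(m, p)) <= \rank (map_mx intr A : 'M[K]_(m, p)))%N.
Proof.
move=> charK; have [f [g]] := full_rank_minor (map_mx intr A : 'M[L]_(m, p)).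
rewrite unitmxE unitfE -map_mxsub det_map_mx => detL.
have detA : \det (mxsub f g A) != 0 by apply: contraNneq detL => ->; rewrite rmorph0.
have : mxsub f g (map_mx intr A : 'M[K]_(m, p)) \in unitmx.
  rewrite unitmxE unitfE -map_mxsub det_map_mx.
  move: detA; case: (\det _) => k; rewrite -?pmulrn ?NegzE ?mulrNz ?oppr_eq0 -?pmulrn;
  by rewrite ((pcharf0P K).1 charK).
by move/mxrank_unit => e; rewrite -[X in (X <= _)%N]e mxrank_mxsub.
Qed.

(** From [L] to [K] no rank drops: the image of the incoming matrix cannot shrink and the kernel of
    the outgoing one cannot grow. The image lies in the kernel, so equality of dimensions over [L]
    forces equality over [K]. *)
Lemma scalar_exact_char0 n (V : pred {set 'I_n}) (L K : fieldType) i :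
  (forall A B C : {set 'I_n}, A \subset B -> B \subset C -> V A -> V C -> V B) ->
  [pchar K] =i pred0 -> scalar_exact V L i -> scalar_exact V K i.
Proof.
move=> conv charK /scalar_exact_kermx exL; apply/scalar_exact_kermx.
have sub : (map_mx intr (coboundary_mx V i) <= kermx (cocycle_mx V K i))%MS.
  by apply/sub_kermxP/coboundary_cocycle_mx.
have := mxrank_leqif_sup sub; case=> _ <-; rewrite eqn_leq mxrankS //=.
have cocE F : cocycle_mx V F i =
    map_mx intr (row_mx (off_level_mx V i) (coboundary_mx V i.+1)) by rewrite map_row_mx.
have r1 := mxrank_intr_le L (coboundary_mx V i) charK.
have := mxrank_intr_le L (row_mx (off_level_mx V i) (coboundary_mx V i.+1)) charK.
rewrite -!cocE => r2; have := mxrankS exL; rewrite !mxrank_ker => r3.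
by apply: leq_trans (leq_trans _ r3) r1; apply: leq_sub2l.
Qed.

(** * Multigraded pieces of the Koszul complex *)

Section Multigrading.
Variables (n : nat) (F : fieldType) (M : 'X_{1..n} -> Prop).
Hypothesis hM : upset M.
Local Notation S := {mpoly F[n]}.
Local Notation var := (fun i : 'I_n => 'X_i : S).
Implicit Types (A B C : {set 'I_n}) (b : 'X_{1..n}).

(** In multidegree b - (1,...,1) the coefficient at [A] has exponent b - (1,...,1) + 1_A;
    subtracting the indicator of the complement of [A] from b expresses this without negative
    entries. *)
Definition comp_mnm (A : {set 'I_n}) : 'X_{1..n} := [multinom (i \notin A : nat) | i < n].

(* The sets indexing the part of the Koszul complex of multidegree b - (1,...,1). *)
Definition graded_sets (b : 'X_{1..n}) : pred {set 'I_n} :=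
  fun A => (comp_mnm A <= b)%MM && ~~ asbool (M (b - comp_mnm A)%MM).

Definition graded_part b (c : {set 'I_n} -> S) A : F :=
  if graded_sets b A then (c A)@_(b - comp_mnm A) else 0.

Lemma comp_mnmD1 A j : j \in A -> comp_mnm (A :\ j) = (comp_mnm A + U_(j))%MM.
Proof.
move=> jA; apply/mnmP => k; rewrite mnmDE mnm1E !mnmE !inE.
by case: (eqVneq k j) => [->|kj]; rewrite ?eqxx ?jA // addn0.
Qed.

Lemma graded_sets_convex b A B C : A \subset B -> B \subset C ->
  graded_sets b A -> graded_sets b C -> graded_sets b B.
Proof.
move=> AB BC /andP[Ab _] /andP[_ /asboolP MC].
have Bb : (comp_mnm B <= b)%MM.
  apply: lepm_trans Ab; apply/mnm_lepP => k; rewrite !mnmE.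
  by case: (boolP (k \in A)) => [/(subsetP AB)->|]; case: (k \in B).
rewrite /graded_sets Bb; apply/asboolP => MB; apply: MC.
rewrite (_ : (b - comp_mnm C)%MM = (b - comp_mnm B + (comp_mnm B - comp_mnm C))%MM); first exact: hM.
apply/mnmP => k; move/mnm_lepP/(_ k): Bb; rewrite mnmDE !mnmBE !mnmE.
case: (boolP (k \in B)) => [/(subsetP BC)->|_] /=; first by lia.
by case: (k \in C) => /=; lia.
Qed.

Lemma graded_kdiff b c B : graded_sets b B ->
  (kdiff var c B)@_(b - comp_mnm B) = kdiff (fun=> 1) (graded_part b c) B.
Proof.
move=> /andP[Bb /asboolP MB]; rewrite /kdiff raddf_sum; apply: eq_bigr => j jB /=.
have -> : ksgn S j B = (ksgn F j B)%:MP by rewrite /ksgn rmorph_sign.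
rewrite mul_mpolyC mcoeffZ mul1r; congr (_ * _).
rewrite /graded_part /graded_sets comp_mnmD1 //.
(* If [b j] is zero, both sides vanish: [B :\ j] is not among the graded sets, and no multiple of
   ['X_j] contains the monomial in question. *)
case: (posnP (b j)) => bj.
  rewrite (_ : (_ <= b)%MM = false) /=; last first.
    apply/mnm_lepP => /(_ j); rewrite mnmDE mnm1E eqxx bj; lia.
  rewrite mulrC; apply: memN_msupp_eq0.
  rewrite (perm_mem (msuppMX _ _)); apply/mapP => -[v _ /mnmP/(_ j)].
  by rewrite mnmDE mnmBE mnm1E eqxx bj.
have Bjb : (comp_mnm B + U_(j) <= b)%MM.
  apply/mnm_lepP => k; move/mnm_lepP/(_ k): Bb; rewrite mnmDE mnm1E !mnmE.
  by case: eqP => [<-|_]; rewrite ?jB //=; lia.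
have E : (b - comp_mnm B)%MM = (U_(j) + (b - (comp_mnm B + U_(j))))%MM.
  apply/mnmP => k; move/mnm_lepP/(_ k): Bjb; rewrite !(mnmDE, mnmBE) mnm1E; lia.
rewrite Bjb ifT; last by apply/asboolP => h; apply: MB; rewrite E addmC; apply: hM.
by rewrite E mulrC mcoeffMX.
Qed.

(** A scalar cochain lifts to a homogeneous Koszul cochain by attaching the monomial dictated by the
    multidegree; a primitive of the lift is projected back to that multidegree. *)
Lemma scalar_exact_koszul d : koszul_mon F M d ->
  forall i b, (i < d)%N -> scalar_exact (graded_sets b) F i.
Proof.
move=> h i b id c c0 hc.
pose C A : S := c A *: 'X_[(b - comp_mnm A)%MM].
have partC A : graded_part b C A = c A.
  rewrite /graded_part /C; case: ifP => [_|/negbT/c0 -> //].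
  by rewrite mcoeffZ mcoeffX eqxx mulr1.
have dC B : kdiff var C B = kdiff (fun=> 1) c B *: 'X_[(b - comp_mnm B)%MM].
  rewrite /kdiff scaler_suml; apply: eq_bigr => j jB; rewrite /C.
  have -> : ksgn S j B = (ksgn F j B)%:MP by rewrite /ksgn rmorph_sign.
  rewrite mul_mpolyC mul1r -scalerA; congr (_ *: _).
  case: (boolP (graded_sets b (B :\ j))) => [/andP[Bjb _]|/c0->]; last by rewrite !scale0r mulr0.
  rewrite -scalerAr -mpolyXD; congr (_ *: 'X_[_]).
  apply/mnmP => k; move/mnm_lepP/(_ k): Bjb; rewrite comp_mnmD1 //.
  by rewrite !(mnmDE, mnmBE) mnm1E; lia.
have [|E hE] := h i C id.
  move=> B cB u; rewrite dC.
  case: (boolP (graded_sets b B)) => [/hc/(_ cB)->|]; first by rewrite scale0r msupp0.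
  rewrite negb_and negbK => /orP[Bb|/asboolP MB].
    rewrite (_ : kdiff _ _ _ = 0) ?scale0r ?msupp0 //.
    rewrite /kdiff big1 // => j jB; rewrite c0 ?mulr0 //; apply: contra Bb => /andP[+ _].
    by rewrite comp_mnmD1 //; apply: lepm_trans; apply: lem_addr.
  by move=> /msuppZ_le; rewrite msuppX inE => /eqP->.
exists (graded_part b E); first by move=> A /negbTE nA; rewrite /graded_part nA.
move=> A VA cA; rewrite -graded_kdiff // -(partC A) /graded_part VA; apply/eqP.
rewrite -subr_eq0 -mcoeffB mcoeff_eq0; apply/negP => /(hE A cA).
by case/andP: VA => _ /asboolP.
Qed.

(** Primitives found separately in each multidegree are reassembled into one Koszul cochain. *)
Lemma koszul_scalar_exact d :
  (forall i b, (i < d)%N -> scalar_exact (graded_sets b) F i) -> koszul_mon F M d.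
Proof.
move=> h i c id hc.
have hb b : exists e : {set 'I_n} -> F, (forall A, ~~ graded_sets b A -> e A = 0) /\
    forall A, graded_sets b A -> #|A| = i -> graded_part b c A = kdiff (fun=> 1) e A.
  have [||e e0 he] := h i b id (graded_part b c).
  - by move=> A /negbTE nA; rewrite /graded_part nA.
  - move=> B VB cB; rewrite -graded_kdiff //; apply: memN_msupp_eq0; apply/negP => /(hc B cB).
    by case/andP: VB => _ /asboolP.
  by exists e.
have [e he] := exists_choice hb.
(* Only the finitely many multidegrees occurring in [c] enter the sum; in the others the graded
   parts of both [c] and [E] are zero. *)
pose bs := undup [seq (u + comp_mnm A)%MM | A <- enum {set 'I_n}, u <- msupp (c A)].
pose E A : S := \sum_(b <- bs) if graded_sets b A then e b A *: 'X_[(b - comp_mnm A)%MM] else 0.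
exists E => A cA u; rewrite mcoeff_msupp => cu; apply: NNPP => nMu.
move/eqP: cu; apply; pose b := (u + comp_mnm A)%MM.
have bA : (b - comp_mnm A)%MM = u by rewrite /b addmK.
have VA : graded_sets b A by rewrite /graded_sets bA lem_addl; apply/asboolP.
rewrite -bA mcoeffB graded_kdiff //.
have -> : (c A)@_(b - comp_mnm A) = graded_part b c A by rewrite /graded_part VA.
have partE B : graded_part b E B = if b \in bs then e b B else 0.
  rewrite /graded_part; case: ifP => [VB|/negbT nVB]; last first.
    by have [-> //] := he b; rewrite if_same.
  rewrite /E raddf_sum /=.
  have z b' : b' != b -> (if graded_sets b' B then e b' B *: 'X_[(b' - comp_mnm B)] else 0 : S)@_(b - comp_mnm B) = 0.
    move=> bb'; case: ifP => [/andP[b'B _]|_]; last by rewrite mcoeff0.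
    rewrite mcoeffZ mcoeffX (negbTE (_ : _ != _)) ?mulr0 //.
    apply: contraNneq bb' => ee; rewrite -(submK b'B) ee submK //.
    by case/andP: VB.
  case: ifP => [bbs|/negbT nb].
    rewrite (bigD1_seq b) ?undup_uniq //= big1 ?addr0; last by move=> b' /z.
    by rewrite VB mcoeffZ mcoeffX eqxx mulr1.
  rewrite big_seq big1 // => b' b'bs; apply: z; apply: contraNneq nb => <- //.
case: (boolP (b \in bs)) partE => [_|nb] partE.
  have [_ ->] // := he b; apply/eqP; rewrite subr_eq0; apply/eqP.
  by apply: eq_bigr => j _; rewrite partE.
rewrite [kdiff _ _ _]big1 ?subr0 => [|j _]; last by rewrite partE !mulr0.
rewrite /graded_part VA; apply: memN_msupp_eq0; apply: contra nb => hu.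
rewrite mem_undup; apply/allpairsPdep; exists A, u; split=> //; first by rewrite mem_enum.
by rewrite -bA.
Qed.

End Multigrading.

Lemma koszul_mon_char0 n (M : 'X_{1..n} -> Prop) (L K : fieldType) d : upset M ->
  [pchar K] =i pred0 -> koszul_mon L M d -> koszul_mon K M d.
Proof.
move=> hM charK h; apply: koszul_scalar_exact => // i b id.
apply: (@scalar_exact_char0 _ _ L) charK _.
  by move=> A B C; apply: graded_sets_convex.
exact: (scalar_exact_koszul hM h).
Qed.

(** * Ideals with a given squarefree radical *)

Section Complex.
Variables (n : nat) (D : {set {set 'I_n}}).
Hypothesis hD : simplicial_complex D.
Implicit Types (F G : {set 'I_n}) (M : 'X_{1..n} -> Prop) (u v : 'X_{1..n}).

Lemma facet_exists : exists F, F \in facets D.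
Proof.
case: hD => /set0Pn[A AD] _.
have [F hF _] := @maxset_exists _ (fun A : {set 'I_n} => A \in D) A AD.
by exists F; rewrite inE.
Qed.

Lemma facet_eq F G : F \in facets D -> G \in facets D -> F \subset G -> F = G.
Proof.
rewrite !inE => /maxsetP[_ hF] /maxsetp GD FG.
by apply/esym/hF.
Qed.

Definition nonface_mnm u : Prop := forall F, F \in facets D -> off_face F u.

Lemma nonface_upset : upset nonface_mnm.
Proof. by move=> u v h F /h /off_face_upset. Qed.

Section Field.
Variable K : fieldType.
Local Notation S := {mpoly K[n]}.
Implicit Types (f g : S) (P Q : S -> Prop).

Lemma stanley_reisnerE : @stanley_reisner n K D = mon_ideal nonface_mnm.
Proof.
have E F : @var_ideal n K (~: F) = mon_ideal (off_face F).
  rewrite var_idealE; congr mon_ideal; apply: pred_ext => u.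
  by split=> -[i iF ui]; exists i => //; move: iF; rewrite inE.
apply: pred_ext => f; split=> [h u uf F FD|h F FD]; first by have := h F FD; rewrite E; apply.
by rewrite E => u /h; apply.
Qed.

Lemma upset_free M F u v : (forall i, i \in F -> forall u, M (u + U_(i))%MM -> M u) ->
  (forall i, i \notin F -> v i = 0%N) -> M (u + v)%MM -> M u.
Proof.
move=> hM; have [k] := ubnP (mdeg v); elim: k v => [//|k IH] v; rewrite ltnS => vk hv.
case: (eqVneq v 0%MM) => [->|v0]; first by rewrite addm0.
have [i vi] : exists i, (0 < v i)%N.
  apply: NNPP => no; move/eqP: v0; apply; apply/mnmP => i; rewrite mnm0E.
  by apply/eqP; rewrite -leqn0 leqNgt; apply/negP => h; apply: no; exists i.
have iF : i \in F by apply: contraLR vi => /hv->.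
have vE : v = (v - U_(i) + U_(i))%MM by rewrite submK // lep1mP -lt0n.
rewrite {1}vE addmA => /(hM i iF) /IH; apply.
  by move: vk; rewrite {1}vE mdegD mdeg1 addn1.
by move=> j /hv vj; rewrite mnmBE vj.
Qed.

Definition off_deg F u : nat := \sum_(i | i \notin F) u i.

Lemma off_degD F u v : off_deg F (u + v) = (off_deg F u + off_deg F v)%N.
Proof. by rewrite /off_deg -big_split; apply: eq_bigr => i _; rewrite mnmDE. Qed.

Lemma off_deg_gt0 F u : (0 < off_deg F u)%N <-> off_face F u.
Proof.
split.
  move=> h; apply: NNPP => no; move: h; rewrite /off_deg big1 // => i iF.
  by apply/eqP; rewrite -leqn0 leqNgt; apply/negP => ui; apply: no; exists i.
by case=> i iF ui; rewrite /off_deg (bigD1 i) //= ltn_addr.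
Qed.

(* Multiplying the part of f supported on F with the component of g (outside M)
   of least degree in the other variables produces a monomial outside M. *)
Lemma regular_extended M F f g : upset M ->
  (forall i, i \in F -> forall u, M (u + U_(i))%MM -> M u) ->
  ~ mon_ideal (off_face F) f -> mon_ideal M (f * g) -> mon_ideal M g.
Proof.
move=> hM freeM nf fg; apply: NNPP => ng.
pose g1 := g - mfilter (fun u => asbool (M u)) g.
have g1M u : u \in msupp g1 -> ~ M u by rewrite msupp_mfilterN => /andP[/asboolP].
have [u1 u1g] : exists u, u \in msupp g1.
  apply: NNPP => no; apply: ng => u ug; apply: NNPP => nu; apply: no; exists u.
  by rewrite msupp_mfilterN ug andbT; apply/asboolP.
have fg1 : mon_ideal M (f * g1).
  rewrite mulrBr; apply: (ideal_sub (mon_idealP K hM) fg).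
  apply: (ideal_mull _ (mon_idealP K hM)) => u.
  by rewrite msupp_mfilter => /andP[/asboolP].
pose f0 := f - mfilter (fun u => asbool (off_face F u)) f.
have f0F u : u \in msupp f0 -> ~ off_face F u by rewrite msupp_mfilterN => /andP[/asboolP].
have f0n : f0 != 0.
  apply/eqP => f0z; apply: nf => u uf; apply: NNPP => nu.
  have : u \in msupp f0 by rewrite msupp_mfilterN uf andbT; apply/asboolP.
  by rewrite f0z msupp0.
have [r hr rmin] : exists2 r, (exists2 u, u \in msupp g1 & off_deg F u = r) &
    forall u, u \in msupp g1 -> (r <= off_deg F u)%N.
  have ex : exists r, has (fun u => off_deg F u == r) (msupp g1).
    by exists (off_deg F u1); apply/hasP; exists u1.
  case: (ex_minnP ex) => r /hasP[u ug /eqP ur] rmin; exists r; first by exists u.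
  by move=> v vg; apply: rmin; apply/hasP; exists v.
pose gr := mfilter (fun u => off_deg F u == r) g1.
have grn : gr != 0.
  case: hr => u ug ur; apply/eqP => grz.
  have : u \in msupp gr by rewrite msupp_mfilter ur eqxx.
  by rewrite grz msupp0.
have [w wfg] : exists w, w \in msupp (f0 * gr).
  have : f0 * gr != 0 by rewrite mulf_neq0.
  rewrite -msupp_eq0; case: (msupp _) => [//|w s _].
  by exists w; apply: mem_head.
have /allpairsP[[v1 v2] /= [v1f v2g wE]] := msuppM_le wfg.
have v1F : off_deg F v1 = 0%N.
  by apply/eqP; rewrite -leqn0 leqNgt; apply/negP => /off_deg_gt0/(f0F _ v1f).
move: (v2g); rewrite msupp_mfilter => /andP[/eqP v2r v2g1].
have wr : off_deg F w = r by rewrite wE off_degD v1F v2r.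
(* [f0 * gr] is the component of [f * g1] of least degree off [F]: all that remains has larger
   degree there, so [w] cannot be cancelled. *)
have big : mon_ideal (fun u => (r < off_deg F u)%N) (f * g1 - f0 * gr).
  have split4 (a b c d : S) : a * b - c * d = (a - c) * b + c * (b - d).
    by rewrite mulrBl mulrBr addrA subrK.
  rewrite split4.
  apply: mon_ideal_add.
    apply: (@mon_ideal_mul _ _ (off_face F) (fun u => (r <= off_deg F u)%N)) => //.
      by move=> u v /off_deg_gt0 hu hv; rewrite off_degD; lia.
    by move=> u; rewrite /f0 subKr msupp_mfilter => /andP[/asboolP].
  apply: (@mon_ideal_mul _ _ (fun=> True) (fun u => (r < off_deg F u)%N)) => //.
    by move=> u v _ hv; rewrite off_degD; lia.
  move=> u; rewrite msupp_mfilterN => /andP[ur /rmin ru].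
  by rewrite ltn_neqAle eq_sym ur.
have : w \in msupp (f * g1).
  rewrite -[f * g1](subrK (f0 * gr)) mcoeff_msupp mcoeffD.
  rewrite (_ : _@_w = 0) ?add0r -?mcoeff_msupp //.
  by apply: memN_msupp_eq0; apply/negP => /big; rewrite wr ltnn.
move/fg1; rewrite wE addmC => /(upset_free freeM) h; apply: (g1M _ v2g1); apply: h.
move=> i iF; apply/eqP; rewrite -leqn0 leqNgt; apply/negP => vi.
by apply: (f0F _ v1f); exists i.
Qed.

Lemma off_face_free F i : i \in F -> forall u, off_face F (u + U_(i))%MM -> off_face F u.
Proof.
move=> iF u [j jF]; rewrite mnmDE mnm1E (negbTE (_ : i != j)) ?addn0; first by exists j.
by apply: contraNneq jF => <-.
Qed.

(** An instance of [regular_extended], since P_F is free in the variables of [F]. *)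
Lemma off_face_prime F : prime_ideal (mon_ideal (off_face F) : S -> Prop).
Proof.
split; first by apply: mon_idealP; apply: off_face_upset.
  by move/(_ 0%MM); rewrite msupp1 mem_head => /(_ isT) [i _]; rewrite mnm0E.
move=> f g fg; apply: NNPP => no.
have nf : ~ mon_ideal (off_face F) f by move=> h; apply: no; left.
apply: no; right; apply: (regular_extended _ _ nf fg); first exact: off_face_upset.
exact: off_face_free.
Qed.

Lemma off_face_le F G : (forall f, mon_ideal (off_face F) f -> mon_ideal (off_face G) f) ->
  G \subset F.
Proof.
move=> h; apply/subsetP => i iG; apply: contraLR (iG) => iF.
have /h/mon_idealX[j jG] : mon_ideal (off_face F) ('X_i : S).
  by apply/mon_idealX; exists i; rewrite ?mnm1E ?eqxx.
by rewrite mnm1E; case: eqP => [->|].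
Qed.

(** * Monomial ideals with radical I_Delta *)

Section Radical.
Variable M : 'X_{1..n} -> Prop.
Hypothesis hM : upset M.
Hypothesis radM : forall f, radical (mon_ideal M) f <-> stanley_reisner D f.
Local Notation I := (mon_ideal M : S -> Prop).

Lemma radical_nonface u : M u -> nonface_mnm u.
Proof.
move=> Mu; apply/(mon_idealX K); rewrite -stanley_reisnerE; apply/radM.
by exists 1%N; rewrite expr1; apply/mon_idealX.
Qed.

Lemma radical_nonfaceX u : nonface_mnm u -> exists k, M (u *+ k)%MM.
Proof.
move/(mon_idealX K); rewrite -stanley_reisnerE => /radM[k].
by rewrite mpolyXn => /mon_idealX; exists k.
Qed.

Lemma radical_proper : ~ M 0%MM.
Proof.
by move/radical_nonface; have [F /[swap]/[apply]] := facet_exists; case=> i _; rewrite mnm0E.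
Qed.

(** Otherwise every P_F has a monomial outside [Q]. The product of these lies in I_Delta, so a power
    of it lies in I and hence in [Q], against primality. *)
Lemma prime_over_radical Q : prime_ideal Q -> (forall f, I f -> Q f) ->
  exists2 F, F \in facets D & forall f, mon_ideal (off_face F) f -> Q f.
Proof.
move=> pQ IQ; have hQ : ideal Q by case: pQ.
apply: NNPP => no.
have [U hU] : exists U : {set 'I_n} -> 'X_{1..n}, forall F, F \in facets D ->
    off_face F (U F) /\ ~ Q 'X_[U F].
  apply: (@exists_choice _ _ (fun F u => F \in facets D -> off_face F u /\ ~ Q 'X_[u])) => F.
  case: (boolP (F \in facets D)) => FD; last by exists 0%MM.
  apply: NNPP => noU; apply: no; exists F => // f; apply: mon_ideal_min => // u uF.
  by apply: NNPP => nQ; apply: noU; exists u.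
have SRp : stanley_reisner D (\prod_(F <- enum (facets D)) 'X_[U F] : S).
  rewrite stanley_reisnerE => u hu F FD; move: u hu; rewrite -/(mon_ideal _ _).
  rewrite (bigD1_seq F) ?mem_enum ?enum_uniq //= mulrC.
  apply: (ideal_mull _ (mon_idealP K (@off_face_upset _ F))).
  by apply/mon_idealX; case: (hU F FD).
have [k /IQ /(prime_idealX pQ)] := (radM _).2 SRp.
case/(prime_ideal_prod pQ) => F; rewrite mem_enum => FD.
by case: (hU F FD).
Qed.

Lemma minimal_prime_facet P : minimal_prime I P ->
  exists2 F, F \in facets D & P = mon_ideal (off_face F).
Proof.
move=> [pP IP minP]; have [F FD FP] := prime_over_radical pP IP.
exists F => //; apply: pred_ext => f; split; last exact: FP.
apply: minP => // [|g Ig]; first exact: off_face_prime.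
by move=> u /Ig /radical_nonface; apply.
Qed.

Lemma facet_minimal_prime F : F \in facets D -> minimal_prime I (mon_ideal (off_face F)).
Proof.
move=> FD; split; first exact: off_face_prime.
  by move=> f If u /If /radical_nonface; apply.
move=> Q pQ IQ QF; have [G GD GQ] := prime_over_radical pQ IQ.
suff -> : F = G by [].
by apply: facet_eq => //; apply: off_face_le => f /GQ /QF.
Qed.

(** The ideal Q_F = (I : x_F^oo), the contraction of the localization of I at P_F. *)
Definition localized F u : Prop :=
  exists2 v : 'X_{1..n}, (forall i, i \notin F -> v i = 0%N) & M (u + v)%MM.

(** For x^u outside I some I : (r x^u) is prime, hence equal to P_F for a facet F. If u were in Q_F,
    a monomial in the variables of F would kill x^u modulo I and thus lie in P_F, which is
    absurd. *)
Lemma unmixed_localized : unmixed I ->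
  M = (fun u => forall F, F \in facets D -> localized F u).
Proof.
move=> unm; apply: pred_ext => u; split.
  by move=> Mu F _; exists 0%MM => [i _|]; rewrite ?mnm0E ?addm0.
move=> hu; apply: NNPP => nMu.
have nI : ~ I 'X_[u] by move/mon_idealX.
have [r nr pr] := assoc_exists (mon_idealP K hM) nI.
have /unm/minimal_prime_facet[F FD E] : associated_prime I (colon I (r * 'X_[u])).
  by split=> //; exists (r * 'X_[u]).
have [v vF Muv] := hu F FD.
have : colon I (r * 'X_[u]) 'X_[v].
  rewrite /colon mulrCA -mpolyXD addmC; apply: (ideal_mull _ (mon_idealP K hM)).
  exact/mon_idealX.
by rewrite E => /mon_idealX[i /vF->].
Qed.

Lemma unmixed_koszul p : unmixed I ->
  (forall t, subseq t (enum (facets D)) -> t != [::] ->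
     (p < #|common_face setT t| + size t)%N) ->
  koszul_mon K M p.
Proof.
move=> unm hp.
have hloc F : upset (localized F).
  move=> u w [v vF Muv]; exists v => //.
  by rewrite -addmA (addmC w) addmA; apply: hM.
rewrite (unmixed_localized unm).
(* The nerve argument is used with [N] empty, that is, starting from the zero ideal. *)
have -> : (fun u => forall F, F \in facets D -> localized F u) =
    (fun u => False \/ forall F, F \in enum (facets D) -> localized F u).
  apply: pred_ext => u; split=> [h|[//|h]]; last by move=> F FD; apply: h; rewrite mem_enum.
  by right=> F; rewrite mem_enum; apply: h.
apply: koszul_mon_nerve => // t ts t0.
apply: (@koszul_vanish_le _ _ _ _ #|common_face setT t|).
  by rewrite leq_subLR addnC; apply: hp.
apply: koszul_mon_free.
  by move=> u v [//|[F Ft h]]; right; exists F => //; apply: hloc.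
move=> i; rewrite /common_face setTI => it u [//|[F Ft [v vF Muv]]]; right; exists F => //.
have iF : i \in F.
  by move: it; rewrite (big_rem F) //= inE => /andP[].
exists (v + U_(i))%MM; last by rewrite (addmC v) addmA.
move=> j jF; rewrite mnmDE vF // mnm1E; case: eqP => // ij.
by rewrite -ij iF in jF.
Qed.

(** Membership of a monomial in I_Delta depends only on its support, and the supports are finite in
    number, so one [k] serves for all. The summand 0 is the residue in [koszul_vanish_dilate]. *)
Lemma radical_dilate : exists2 k, (0 < k)%N &
  forall u, nonface_mnm u <-> M [multinom (k * u i + 0)%N | i < n].
Proof.
pose ind (B : {set 'I_n}) : 'X_{1..n} := [multinom (i \in B : nat) | i < n].
have [e he] : exists e : {set 'I_n} -> nat, forall B, nonface_mnm (ind B) -> M (ind B *+ e B)%MM.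
  apply: (@exists_choice _ _ (fun B k => nonface_mnm (ind B) -> M (ind B *+ k)%MM)) => B.
  case: (classic (nonface_mnm (ind B))) => [/radical_nonfaceX[k h]|h]; first by exists k.
  by exists 0%N.
(* The sum dominates every [e B], and the successor makes it positive. *)
exists (\sum_B e B).+1 => // u; split.
  move=> hu; pose B := [set i | 0 < u i]%N.
  have hB : nonface_mnm (ind B).
    by move=> F /hu[i iF ui]; exists i; rewrite // mnmE inE ui.
  set w := [multinom _ | _ < _].
  have le : (ind B *+ e B <= w)%MM.
    apply/mnm_lepP => i; rewrite mulmnE !mnmE inE addn0.
    case: posnP => [_|ui] /=; first by rewrite mul0n.
    rewrite mul1n; apply: (@leq_trans (\sum_B e B)).
      by rewrite (bigD1 B) //= leq_addr.
    by apply: leq_trans (leqnSn _) _; rewrite leq_pmulr.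
  by rewrite -(submK le) addmC; apply: hM; apply: he.
move/radical_nonface => h F /h[i iF]; rewrite mnmE addn0 muln_gt0 /= => ui.
by exists i.
Qed.

(** The lower bound is [unmixed_koszul]; for the upper one, S/I_Delta is a direct summand of S/I
    once k-th powers replace the variables. *)
Lemma unmixed_is_depth p : unmixed I ->
  (forall t, subseq t (enum (facets D)) -> t != [::] ->
     (p < #|common_face setT t| + size t)%N) ->
  ~ koszul_mon K nonface_mnm p.+1 -> is_depth (var_ideal [set: 'I_n]) I p.
Proof.
move=> unm hp nv; have [k k0 hk] := radical_dilate.
apply: (@is_depth_koszul _ _ _ _ k) => //; first exact: radical_proper.
  exact: unmixed_koszul.
by move=> h; apply: nv; apply: koszul_vanish_dilate hk h.
Qed.

End Radical.

(** * Unmixed ideals with a prescribed exponent at each facet *)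

Section Weighted.
Variables (wt : {set 'I_n} -> nat) (W : nat).
Hypothesis wt_gt0 : forall F, (0 < wt F)%N.
Hypothesis wt_le : forall F, (wt F <= W)%N.

(** The intersection over the facets F of the irreducible ideals (x_i^(wt F) : i not in F). *)
Definition weighted_mnm u : Prop :=
  forall F, F \in facets D -> exists2 i, i \notin F & (wt F <= u i)%N.

Lemma weighted_upset : upset weighted_mnm.
Proof.
by move=> u v h F /h[i iF le]; exists i => //; rewrite mnmDE (leq_trans le) ?leq_addr.
Qed.

Lemma weighted_radical f :
  radical (mon_ideal weighted_mnm) f <-> stanley_reisner D f.
Proof.
rewrite stanley_reisnerE; split.
  case=> k fk; suff h F : F \in facets D -> mon_ideal (off_face F) f.
    by move=> u uf F /h; apply.
  move=> FD; apply: (prime_idealX (off_face_prime F)) (_ : mon_ideal (off_face F) (f ^+ k)).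
  by move=> u /fk/(_ F FD)[i iF le]; exists i => //; apply: leq_trans le.
(* All monomials of the k-th power of [f] have degree at least k off [F]; once this exceeds [n * W],
   some exponent off [F] exceeds [W], hence [wt F]. *)
move=> hf; exists (n * W).+1.
suff h F : F \in facets D ->
    mon_ideal (fun u => exists2 i, i \notin F & (wt F <= u i)%N) (f ^+ (n * W).+1).
  by move=> u uf F /h; apply.
move=> FD.
have hk k : mon_ideal (fun u => (k <= off_deg F u)%N) (f ^+ k).
  elim: k => [|k IH]; first by move=> u.
  rewrite exprS; apply: (mon_ideal_mul _ hf IH) => u v /(_ F FD)/off_deg_gt0.
  by rewrite off_degD; lia.
move=> u /hk big; apply: NNPP => no; move: big; apply/negP; rewrite -ltnNge ltnS.
apply: (@leq_trans (\sum_(i < n) W)); last by rewrite sum_nat_const card_ord.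
rewrite /off_deg big_mkcond; apply: leq_sum => i _; case: ifP => // iF.
rewrite leqNgt; apply/negP => lt; apply: no; exists i => //.
exact: leq_trans (wt_le F) (ltnW lt).
Qed.

(** An associated prime, annihilator of [g], lies in P_F for a component at [F] missing [g], by
    [regular_extended]. It also contains some P_G, and incomparability of facets gives F = G.
    Conversely each P_F is the annihilator of an explicit monomial. *)
Lemma weighted_unmixed : unmixed (mon_ideal weighted_mnm : S -> Prop).
Proof.
have hI := mon_idealP K weighted_upset.
move=> P; split.
  case=> pP [g hg].
  have ng : ~ mon_ideal weighted_mnm g.
    by case: pP => _ n1 _ h; apply: n1; apply/hg; rewrite mul1r.
  have [F FD ngF] : exists2 F, F \in facets D &
      ~ mon_ideal (fun u => exists2 i, i \notin F & (wt F <= u i)%N) g.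
    apply: NNPP => no; apply: ng => u ug F FD; apply: NNPP => nu; apply: no.
    by exists F => // h; apply: nu; apply: h.
  have PF f : P f -> mon_ideal (off_face F) f.
    move/hg => fg; apply: NNPP => nf; apply: ngF; apply: (regular_extended _ _ nf).
    - by move=> u v [i iF le]; exists i => //; rewrite mnmDE (leq_trans le) ?leq_addr.
    - move=> i iF u [j jF le]; exists j => //; move: le.
      by rewrite mnmDE mnm1E (negbTE (_ : i != j)) ?addn0 //; apply: contraNneq jF => <-.
    by move=> u /fg; apply.
  have IP f : mon_ideal weighted_mnm f -> P f.
    by move=> If; apply/hg; rewrite mulrC; apply: (ideal_mull g hI).
  have [G GD GP] := prime_over_radical weighted_radical pP IP.
  have eFG : F = G by apply: facet_eq => //; apply: off_face_le => f /GP /PF.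
  have -> : P = mon_ideal (off_face F).
    by apply: pred_ext => f; split; [apply: PF|rewrite eFG; apply: GP].
  by apply: facet_minimal_prime => //; apply: weighted_radical.
move/(minimal_prime_facet weighted_radical) => [F FD ->].
split; first exact: off_face_prime.
(* The exponent [W] on [F] puts x^v into the components of all other facets, while off [F] it stops
   one short of the component at [F]. *)
pose v : 'X_{1..n} := [multinom if i \in F then W else (wt F).-1 | i < n].
exists 'X_[v] => f; rewrite mon_idealMX.
suff h u : off_face F u <-> weighted_mnm (v + u)%MM.
  by split; apply: mon_ideal_sub => u; apply h.
split.
  case=> i iF ui G GD; case: (eqVneq G F) => [->|GF].
    exists i => //; rewrite mnmDE mnmE (negbTE iF).
    by have := wt_gt0 F; lia.
  have /subsetPn[j jF jG] : ~~ (F \subset G).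
    by apply: contraNN GF => FG; rewrite (facet_eq FD GD FG).
  by exists j => //; rewrite mnmDE mnmE jF (leq_trans (wt_le G)) ?leq_addr.
move/(_ F FD) => [i iF]; rewrite mnmDE mnmE (negbTE iF) => le; exists i => //.
by have := wt_gt0 F; lia.
Qed.

End Weighted.

End Field.

(** [p] is the expected depth. The minimum is a successor because the family [s] attaining it is
    nonempty; subsequences of the enumeration stand for sets of facets. *)
Lemma min_intersection : exists p, exists s,
  [/\ subseq s (enum (facets D)), s != [::], #|common_face setT s| + size s = p.+1 &
      forall t, subseq t (enum (facets D)) -> t != [::] ->
        p < #|common_face setT t| + size t]%N.
Proof.
pose good k := exists s, [/\ subseq s (enum (facets D)), s != [::] &
  #|common_face setT s| + size s = k]%N.
have [F FD] := facet_exists.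
have ex : exists k, asbool (good k).
  exists (#|common_face setT [:: F]| + size [:: F])%N; apply/asboolP; exists [:: F].
  by split=> //; rewrite sub1seq mem_enum.
case: (ex_minnP ex) => k /asboolP[s [ss s0 sk]] kmin.
case: k sk kmin => [|p] sk kmin.
  by move/eqP: sk; rewrite addn_eq0 size_eq0 (negbTE s0) andbF.
exists p, s; split=> // t ts t0; apply: kmin; apply/asboolP; by exists t.
Qed.

End Complex.

(** * Transfer of rigidity from characteristic 0 to an arbitrary field *)

Lemma is_depth_uniq (R : comNzRingType) (m I : R -> Prop) d e :
  is_depth m I d -> is_depth m I e -> d = e.
Proof.
move=> [[s [<- sm rs]] hs] [[t [<- tm rt]] ht].
by apply/eqP; rewrite eqn_leq ht // hs.
Qed.

Theorem corollary2p5 (n : nat) (D : {set {set 'I_n}})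
    (hD : simplicial_complex D) (pureD : pure D)
    (K : fieldType) (charK : [pchar K] =i pred0)
    (rigidK : rigid_depth K D)
    (L : fieldType) :
  rigid_depth L D.
Proof.
have [p [s [ss s0 sp hp]]] := min_intersection hD.
have [G Gs] : exists G, G \in s.
  by case: (s) s0 => [//|G s' _]; exists G; apply: mem_head.
(* Squares at the facets of a minimizing family, the prime P_F at all others. *)
pose wt F : nat := if F \in s then 2 else 1.
have wt_gt0 F : (0 < wt F)%N by rewrite /wt; case: ifP.
have wt_le F : (wt F <= 2)%N by rewrite /wt; case: ifP.
have sD F : F \in s -> F \in facets D by move/(mem_subseq ss); rewrite mem_enum.
have depthK : is_depth (var_ideal [set: 'I_n]) (mon_ideal (weighted_mnm D wt) : {mpoly K[n]} -> Prop) p.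
  have hw := @weighted_upset n D wt.
  have hr := @weighted_radical n D K wt 2 wt_gt0 wt_le.
  have hu := @weighted_unmixed n D K wt 2 wt_gt0 wt_le.
  apply: (@is_depth_koszul _ _ _ _ 2) => //.
  - exact: (radical_proper hD hr).
  - exact: (unmixed_koszul hw hr hu hp).
  move=> h.
  have nv := @koszul_mon_simplicesN n K setT s p.+1 s0.
  apply: nv; first by rewrite sp.
    by move=> t ts; apply: hp; apply: subseq_trans ts ss.
  (* Extraction of odd exponents: 2u + 1 >= 2 means u > 0, whereas 2u + 1 >= 1 always holds, so only
     the components at the facets of [s] survive, as the primes P_F. *)
  apply: (@koszul_vanish_dilate _ _ _ _ 2 1 _ _ _ h) => // u; split.
    case=> [[i]|hs F FD]; first by rewrite inE.
    case: (boolP (F \in s)) => Fs.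
      by have [i iF ui] := hs F Fs; exists i; rewrite // mnmE /wt Fs; lia.
    (* A facet outside [s] omits some vertex; otherwise it would contain the facet [G] of [s] and so
       equal it. *)
    have [i iF] : exists i, i \notin F.
      apply: NNPP => no; move/negP: Fs; apply.
      rewrite -(facet_eq (sD G Gs) FD) //.
      by apply/subsetP => i _; apply: NNPP => iF; apply: no; exists i; apply/negP.
    by exists i; rewrite // mnmE /wt (negbTE Fs) addn1.
  move=> hu'; right=> F Fs; have [i iF] := hu' F (sD F Fs).
  by rewrite mnmE /wt Fs => ui; exists i => //; lia.
(* Vanishing over [L] would pass to [K], where rigidity forces S/I_Delta to have the depth [p] of
   the weighted ideal. *)
have nvL : ~ koszul_mon L (nonface_mnm D) p.+1.
  move/(koszul_mon_char0 (nonface_upset (D := D)) charK).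
  apply: is_depth_koszulN; first exact: nonface_upset.
    move=> h0; have [F /h0[i _]] := facet_exists hD; by rewrite mnm0E.
  rewrite -stanley_reisnerE; apply: (rigidK _ _ _ _ p).1 depthK.
  - exact/mon_ideal_monomial/weighted_upset.
  - exact: weighted_unmixed wt_gt0 wt_le.
  - exact: weighted_radical wt_gt0 wt_le.
have depthL I : monomial_ideal I -> unmixed I ->
    (forall f : {mpoly L[n]}, radical I f <-> stanley_reisner D f) ->
    is_depth (var_ideal [set: 'I_n]) I p.
  move=> /monomial_idealP[M hM ->] unm rad.
  exact: (unmixed_is_depth hD hM rad unm hp nvL).
(* I_Delta is the weighted ideal with all weights 1, so [depthL] applies to it as well. *)
have depthSR : is_depth (var_ideal [set: 'I_n]) (stanley_reisner (K := L) D) p.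
  rewrite stanley_reisnerE.
  have -> : nonface_mnm D = weighted_mnm D (fun=> 1%N) by [].
  apply: depthL.
  - exact/mon_ideal_monomial/weighted_upset.
  - exact: (@weighted_unmixed _ _ L (fun=> 1%N) 1%N).
  - exact: (@weighted_radical _ _ L (fun=> 1%N) 1%N).
move=> I mI unm rad d; have dI := depthL I mI unm rad.
by split=> [/(is_depth_uniq dI)<-|/(is_depth_uniq depthSR)<-].
Qed.
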